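(* Let $\theta=\{\alpha,\beta_P,\beta_Q,\gamma,c_\lambda,r_\lambda,C_\beta,C_\alpha,C_\gamma\}$ be fixed, and let the classes $\Pi(\theta)$, $\Pi'(\theta)$ and the excess risk $\mathcal{R}_Q$ be as defined in the context. Then there is a constant $c>0$ depending on $\theta$ such that: (a) If $\beta_P>\gamma\beta_Q$ and $\alpha\beta_P\le\gamma d$, then $$\inf_{\widehat f}\sup_{(P,Q)\in\Pi(\theta)}\mathcal{R}_Q(\widehat f)\ge\inf_{\widehat f}\sup_{(P,Q)\in\Pi'(\theta)}\mathcal{R}_Q(\widehat f)\ge c\Big(n_P^{\frac{2\beta_P+\gamma d}{\gamma(2\beta_P+d)}}+n_Q\Big)^{-\frac{\beta_P(1+\alpha)}{2\beta_P+\gamma d}}.$$ (b) If $\beta_P\le\gamma\beta_Q$ and $\alpha\beta_Q\le d$, then $$\inf_{\widehat f}\sup_{(P,Q)\in\Pi(\theta)}\mathcal{R}_Q(\widehat f)\ge\inf_{\widehat f}\sup_{(P,Q)\in\Pi'(\theta)}\mathcal{R}_Q(\widehat f)\ge c\Big(n_P^{\frac{2\beta_Q+d}{2\gamma\beta_Q+d}}+n_Q\Big)^{-\frac{\beta_Q(1+\alpha)}{2\beta_Q+d}}.$$ Here the infimum is taken over all classifiers $\widehat f$ constructed from the entire data $(\mathbf{X}_1^P,Y_1^P),\dots,(\mathbf{X}_{n_P}^P,Y_{n_P}^P),(\mathbf{X}_1^Q,Y_1^Q),\dots,(\mathbf{X}_{n_Q}^Q,Y_{n_Q}^Q)$.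
   Context: Notation. $d\ge1$ is a fixed dimension, $\|\cdot\|$ is the Euclidean norm, $B(\mathbf{x},r)$ is the Euclidean ball of radius $r$ centered at $\mathbf{x}$, $\lambda$ is Lebesgue measure on $\mathbb{R}^d$. Model. $P,Q$ are probability distributions on $[0,1]^d\times\{0,1\}$; a draw is written $(\mathbf{X},Y)$. $P_{\mathbf{X}},Q_{\mathbf{X}}$ are the marginal distributions of $\mathbf{X}$, and $\eta_P(\mathbf{x})=P(Y=1|\mathbf{X}=\mathbf{x})$, $\eta_Q(\mathbf{x})=Q(Y=1|\mathbf{X}=\mathbf{x})$. The data are $n_P$ i.i.d. observations $(\mathbf{X}_i^P,Y_i^P)$ from $P$ and $n_Q$ i.i.d. observations $(\mathbf{X}_i^Q,Y_i^Q)$ from $Q$, all mutually independent. Classes $\Pi(\theta)$ and $\Pi'(\theta)$. Let $\theta=\{\alpha,\beta_P,\beta_Q,\gamma,c_\lambda,r_\lambda,C_\beta,C_\alpha,C_\gamma\}$ with $\alpha\ge0$, $\beta_P,\beta_Q\in[0,1]$, $\max(\beta_P,\beta_Q)>0$, $\gamma,c_\lambda,r_\lambda,C_\beta,C_\alpha>0$ and $0<C_\gamma<1$. $\Pi(\theta)$ is the set of all pairs $(P,Q)$ satisfying, for some $\Omega\subset[0,1]^d$: (i) (common support and strong density) $\Omega$ is the common support of $P_{\mathbf{X}}$ and $Q_{\mathbf{X}}$; $\lambda[\Omega\cap B(\mathbf{x},r)]\ge c_\lambda\lambda[B(\mathbf{x},r)]$ for all $0<r<r_\lambda$ and $\mathbf{x}\in\Omega$;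 and $c_\lambda<\frac{dP_{\mathbf{X}}}{d\lambda}(\mathbf{x})<c_\lambda^{-1}$, $c_\lambda<\frac{dQ_{\mathbf{X}}}{d\lambda}(\mathbf{x})<c_\lambda^{-1}$ for all $\mathbf{x}\in\Omega$. (ii) (Hölder smoothness) $|\eta_P(\mathbf{x}_1)-\eta_P(\mathbf{x}_2)|\le C_\beta\|\mathbf{x}_1-\mathbf{x}_2\|^{\beta_P}$ and $|\eta_Q(\mathbf{x}_1)-\eta_Q(\mathbf{x}_2)|\le C_\beta\|\mathbf{x}_1-\mathbf{x}_2\|^{\beta_Q}$ for all $\mathbf{x}_1,\mathbf{x}_2\in\Omega$. (iii) (Tsybakov noise) $Q_{\mathbf{X}}(|\eta_Q(\mathbf{X})-1/2|<t)\le C_\alpha t^\alpha$ for all $t\in(0,1/2]$. (iv) (relative signal exponent) for all $\mathbf{x}\in\Omega$, $(\eta_P(\mathbf{x})-1/2)(\eta_Q(\mathbf{x})-1/2)\ge0$ and $|\eta_P(\mathbf{x})-1/2|\ge C_\gamma|\eta_Q(\mathbf{x})-1/2|^\gamma$. $\Pi'(\theta)$ is the set of $(P,Q)$ satisfying (i), (ii), (iii) and (iv') (mutual relative signal exponent) for all $\mathbf{x}\in\Omega$, $(\eta_P(\mathbf{x})-1/2)(\eta_Q(\mathbf{x})-1/2)\ge0$ and $C_\gamma|\eta_Q(\mathbf{x})-1/2|^\gamma\le|\eta_P(\mathbf{x})-1/2|\le C_\gamma^{-1}|\eta_Q(\mathbf{x})-1/2|^\gamma$. Excess risk. For a classifier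 $f$ with values in $\{0,1\}$, $\mathcal{E}_Q(f)=Q(f(\mathbf{X})\ne Y)$. Let $f_Q^*(\cdot)=\mathbb{I}(\eta_Q(\cdot)\ge1/2)$. For a data-dependent classifier $\widehat f$, $\mathcal{R}_Q(\widehat f)=\mathbb{E}(\mathcal{E}_Q(\widehat f))-\mathcal{E}_Q(f_Q^* )$, the expectation being over the training data.
   Formalization: The constants c_λ and C_α are required to be, respectively, small enough and large enough, with thresholds depending only on d and the other entries of θ; for arbitrary values the claim fails (e.g. the classes are empty when c_λ ≥ 1). *)

(* Defs.v *)
From HB Require Import structures.
From mathcomp Require Import all_boot all_order all_algebra.
From mathcomp Require Import all_classical all_reals all_analysis.

Set Implicit Arguments.
Unset Strict Implicit.
Unset Printing Implicit Defensive.
Import Order.TTheory GRing.Theory Num.Theory.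
Import numFieldNormedType.Exports.

Local Open Scope classical_set_scope.
Local Open Scope ring_scope.

Section cons_pair.
Context d (T : measurableType d) (n : nat).

Definition cons_pair (p : T * n.-tuple T) : n.+1.-tuple T :=
  [tuple of p.1 :: p.2].

Let measurable_cons_pair : measurable_fun setT cons_pair.
Proof. exact: (measurable_cons measurable_fst measurable_snd). Qed.

HB.instance Definition _ :=
  isMeasurableFun.Build _ _ _ _ cons_pair measurable_cons_pair.

End cons_pair.

Section cons_measure.
Context d (T : measurableType d) (R : realType) (n : nat).
Variables (mu : {sigma_finite_measure set T -> \bar R}).
Variable m : {sigma_finite_measure set (n.-tuple T) -> \bar R}.
Local Open Scope ereal_scope.

Definition cons_measure := pushforward (mu \x m) (@cons_pair _ T n).

Let nu0 : cons_measure set0 = 0. Proof. exact: measure0. Qed.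
Let nu_ge0 A : 0 <= cons_measure A. Proof. exact: measure_ge0. Qed.
Let nu_sigma_additive : semi_sigma_additive cons_measure.
Proof. exact: measure_semi_sigma_additive. Qed.

HB.instance Definition _ := isMeasure.Build _ _ _ cons_measure
  nu0 nu_ge0 nu_sigma_additive.

Let nu_sigma_finite : sigma_finite setT cons_measure.
Proof.
have /sigma_finiteP[F [FT ndF Foo]] := sigma_finiteT mu.
have /sigma_finiteP[G [GT ndG Goo]] := sigma_finiteT m.
pose g (t : n.+1.-tuple T) : T * n.-tuple T := (thead t, [tuple of behead t]).
have mg : measurable_fun setT g.
  by apply/measurable_fun_pair; [exact: measurable_tnth|
                                 exact: measurable_behead].
have gK p : g (cons_pair p) = p.
  by case: p => x t; rewrite /g /cons_pair/= theadE; congr pair; exact/val_inj.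
exists (fun k => g @^-1` (F k `*` G k)).
  apply/esym/seteqP; split=> // t _.
  have [i _ Fi] : (\bigcup_k F k) (g t).1 by rewrite -FT.
  have [j _ Gj] : (\bigcup_k G k) (g t).2 by rewrite -GT.
  exists (maxn i j) => //; split.
    by move: Fi; exact/subsetPset/ndF/leq_maxl.
  by move: Gj; exact/subsetPset/ndG/leq_maxr.
move=> k; have [mF Fk] := Foo k; have [mG Gk] := Goo k; split.
  by rewrite -[X in measurable X]setTI; apply: mg => //; exact: measurableX.
rewrite /cons_measure /pushforward -comp_preimage.
rewrite (_ : _ @^-1` _ = F k `*` G k); last first.
  by apply/funext => p; rewrite -[LHS]/((F k `*` G k) (g (cons_pair p))) gK.
by rewrite product_measure1E// lte_mul_pinfty// ge0_fin_numE.
Qed.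

HB.instance Definition _ :=
  Measure_isSigmaFinite.Build _ _ _ cons_measure nu_sigma_finite.

End cons_measure.

Section tuple_measure.
Context d (T : measurableType d) (R : realType).
Local Open Scope ereal_scope.

(* n-fold product of mu with itself: the law of n i.i.d. draws when mu is a
   probability, Lebesgue measure on R^n when mu is Lebesgue measure on R. *)
Fixpoint tuple_measure (mu : {sigma_finite_measure set T -> \bar R}) n :
    {sigma_finite_measure set (n.-tuple T) -> \bar R} :=
  if n is m.+1 then cons_measure mu (@tuple_measure mu m)
  else \d_ [tuple].

Lemma tuple_measure_box mu n (A : 'I_n -> set T) :
  (forall i, measurable (A i)) ->
  tuple_measure mu n [set t | forall i, A i (tnth t i)] =
  \prod_(i < n) mu (A i).
Proof.
elim: n A => [|n IH] A mA /=.
  by rewrite big_ord0 diracE mem_set// => -[].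
rewrite big_ord_recl -IH// -product_measure1E//; last first.
  rewrite [X in measurable X](_ : _ =
      \bigcap_(i in [set: 'I_n]) (@tnth _ T ^~ i) @^-1` (A (lift ord0 i))).
    apply: fin_bigcap_measurable => // i _.
    by rewrite -[X in measurable X]setTI; exact: measurable_tnth.
  by apply/seteqP; split => t /= tA i; [move=> _|]; exact: tA.
congr product_measure1; apply/seteqP; split => -[x t] /=.
  move=> xtA; split; first by have := xtA ord0; rewrite tnth0.
  by move=> i; have := xtA (lift ord0 i); rewrite tnthS.
move=> [xA tA] i; case: (unliftP ord0 i) => [j ->|->].
  by rewrite tnthS.
by rewrite tnth0.
Qed.

Lemma tuple_measure_probability (P : probability T R) n :
  tuple_measure P n setT = 1.
Proof.
have := @tuple_measure_box P n (fun=> setT) (fun=> measurableT).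
rewrite big1 => [<-|i _]; last exact: probability_setT.
by congr (tuple_measure _ _ _); apply/seteqP; split.
Qed.

End tuple_measure.

Section model.
Context (R : realType) (d : nat).

Definition point := d.-tuple (measurableTypeR R).

Definition edist (x y : point) : R :=
  Num.sqrt (\sum_(i < d) (tnth x i - tnth y i) ^+ 2).

Definition eball (x : point) (r : R) : set point := [set y | edist x y < r].

Definition unit_cube : set point :=
  [set x | forall i : 'I_d, 0 <= tnth x i <= 1].

Definition lambda : set point -> \bar R :=
  tuple_measure (@lebesgue_measure R) d.

(* An observation is a pair (X, Y), the label 1 being [true]. *)
Definition obs := (point * bool)%type.

Definition marginal (P : set obs -> \bar R) : set point -> \bar R :=
  pushforward P fst.

Definition support (mu : set point -> \bar R) : set point :=
  [set x | forall r : R, 0 < r -> (0 < mu (eball x r))%E].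

Definition is_density (mu : set point -> \bar R) (p : point -> R) :=
  [/\ measurable_fun setT p, forall x, 0 <= p x &
   forall A, measurable A -> mu A = (\int[lambda]_(x in A) (p x)%:E)%E].

(* eta is a version of the conditional probability P(Y = 1 | X = x). *)
Definition is_regression (P : set obs -> \bar R) (eta : point -> R) :=
  [/\ measurable_fun setT eta, forall x, 0 <= eta x <= 1 &
   forall A, measurable A ->
     P (A `*` [set true]) = (\int[marginal P]_(x in A) (eta x)%:E)%E].

Record parameters := Theta {
  alpha : R; betaP : R; betaQ : R; gamma : R;
  c_lambda : R; r_lambda : R; C_beta : R; C_alpha : R; C_gamma : R }.

Definition admissible (theta : parameters) :=
  [/\ 0 <= alpha theta,
      0 <= betaP theta <= 1, 0 <= betaQ theta <= 1 &
      0 < Num.max (betaP theta) (betaQ theta)] /\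
  [/\ 0 < gamma theta, 0 < c_lambda theta, 0 < r_lambda theta,
      0 < C_beta theta & 0 < C_alpha theta] /\
  0 < C_gamma theta < 1.

Section conditions.
Variable theta : parameters.
Implicit Types (P Q : set obs -> \bar R) (Omega : set point)
  (etaP etaQ : point -> R).

(* A density is only determined almost everywhere, so the bounds are asked of
   some version of it. *)
Definition density_bounded (mu : set point -> \bar R) Omega :=
  exists2 p, is_density mu p &
    forall x, Omega x -> c_lambda theta < p x < (c_lambda theta)^-1.

Definition strong_density P Q Omega :=
  [/\ Omega = support (marginal P), Omega = support (marginal Q),
      forall r x, 0 < r < r_lambda theta -> Omega x ->
        ((c_lambda theta)%:E * lambda (eball x r) <=
         lambda (Omega `&` eball x r))%E,
      density_bounded (marginal P) Omega &
      density_bounded (marginal Q) Omega].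

Definition hoelder (beta : R) Omega (eta : point -> R) :=
  forall x1 x2, Omega x1 -> Omega x2 ->
    `|eta x1 - eta x2| <= C_beta theta * edist x1 x2 `^ beta.

Definition tsybakov_noise Q etaQ :=
  forall t, 0 < t <= 1 / 2 ->
    (marginal Q [set x | (`|etaQ x - 1 / 2| < t)%R] <=
     (C_alpha theta * t `^ alpha theta)%:E)%E.

Definition relative_signal Omega etaP etaQ :=
  forall x, Omega x ->
    0 <= (etaP x - 1 / 2) * (etaQ x - 1 / 2) /\
    C_gamma theta * `|etaQ x - 1 / 2| `^ gamma theta <= `|etaP x - 1 / 2|.

Definition mutual_relative_signal Omega etaP etaQ :=
  forall x, Omega x ->
    0 <= (etaP x - 1 / 2) * (etaQ x - 1 / 2) /\
    C_gamma theta * `|etaQ x - 1 / 2| `^ gamma theta <= `|etaP x - 1 / 2|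
      <= (C_gamma theta)^-1 * `|etaQ x - 1 / 2| `^ gamma theta.

(* The regression functions are only determined almost everywhere, and the
   pointwise conditions are asked of some versions of them. *)
Definition in_class (signal : set point -> (point -> R) -> (point -> R) -> Prop)
    P Q :=
  P (unit_cube `*` setT) = 1%E /\ Q (unit_cube `*` setT) = 1%E /\
  exists Omega etaP etaQ,
    [/\ Omega `<=` unit_cube, is_regression P etaP & is_regression Q etaQ] /\
    [/\ strong_density P Q Omega,
        hoelder (betaP theta) Omega etaP /\ hoelder (betaQ theta) Omega etaQ,
        tsybakov_noise Q etaQ &
        signal Omega etaP etaQ].

Definition Pi : set (probability obs R * probability obs R) :=
  [set PQ : probability obs R * probability obs R |
    in_class relative_signal PQ.1 PQ.2].

Definition Pi' : set (probability obs R * probability obs R) :=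
  [set PQ : probability obs R * probability obs R |
    in_class mutual_relative_signal PQ.1 PQ.2].

End conditions.

(* A version of the regression function; the risk of the Bayes classifier does
   not depend on which one. *)
Definition regression (Q : set obs -> \bar R) : point -> R :=
  xget (cst 0) [set eta | is_regression Q eta].

Definition bayes (Q : set obs -> \bar R) (x : point) : bool :=
  1 / 2 <= regression Q x.

Definition risk (Q : set obs -> \bar R) (f : point -> bool) : \bar R :=
  Q [set z | f z.1 != z.2].

Section minimax.
Variables nP nQ : nat.

Definition sample := (nP.-tuple obs * nQ.-tuple obs)%type.

Definition sample_law (P Q : probability obs R) : set sample -> \bar R :=
  (tuple_measure P nP \x tuple_measure Q nQ)%E.

(* Jointly measurable in the training sample and the point to classify. *)
Definition classifier := {mfun (sample * point)%type >-> bool}.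

Definition excess_risk (f : classifier)
    (PQ : probability obs R * probability obs R) : \bar R :=
  (\int[sample_law PQ.1 PQ.2]_S risk PQ.2 (fun x => f (S, x))
   - risk PQ.2 (bayes PQ.2))%E.

Definition minimax_risk (C : set (probability obs R * probability obs R)) :
    \bar R :=
  ereal_inf (range (fun f : classifier => ereal_sup (excess_risk f @` C))).

End minimax.
End model.

(* Main.v *)
(* Both regimes are one, with the smoothness [b = max (betaP / gamma) betaQ]:
   take [eta_Q = 1/2 +- kappa w^b] and
   [eta_P = 1/2 +- kappa^gamma w^(gamma b)], where the width [w] equals the mesh
   [r] on the corner cube [[0, s)^d], [s^d ~ r^(alpha b)], and grows with the
   distance to that cube outside. The sign is free on every grid cell of the
   corner and positive elsewhere. Both marginals are uniform on a product of
   combs of period [r]: the gaps keep points of opposite sign [r / 2] apart,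
   which makes the regression functions Hoelder, and every ball centred in the
   domain keeps a fixed fraction of its volume.
   Two hypotheses that differ on one cell cannot be told apart as long as
   [nP r^(2 gamma b + d)] and [nQ r^(2 b + d)] are small, because the squared
   Hellinger affinity tensorizes. Summing over all sign patterns (Assouad), any
   classifier errs with a fixed probability at each point of the corner, which
   costs [r^b s^d ~ r^(b (1 + alpha))]; choose the smallest admissible [r]. *)
From HB Require Import structures.
Require Import Defs.
From mathcomp Require Import all_boot all_order all_algebra.
From mathcomp Require Import all_classical all_reals all_analysis.
From mathcomp Require Import measurable_realfun ring lra.

Import Order.TTheory GRing.Theory Num.Theory.
Import numFieldNormedType.Exports.

Local Open Scope classical_set_scope.
Local Open Scope ring_scope.

(** * Labelled laws with a given regression function *)

(** The strong density condition rules out the usual device of thinning the design where labels are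
    hard to guess: wherever mass sits, its density is bounded below. The hard region must therefore
    be small in volume, and around it the width leaves [r] at unit speed: fast enough for the noise
    condition, slowly enough (1-Lipschitz) for the Hoelder conditions. The set of width below [tau]
    lies in a corner of side of order [r^(alpha b / d) + tau], and [tau <= tau^(alpha b / d)] for
    [tau <= 1] because [alpha b <= d], which is the hypothesis of either regime. The exponent [b] is
    the least one with [betaQ <= b] and [betaP <= gamma b]. The signal condition then holds with
    constant 1, which lies between [C_gamma] and its inverse. Affinity is handled in a dual form, as
    an inequality between integrals of test functions, so no density of a sample law is formed.
    Integrating a test over one factor gives a test on the other, whence products; the two-point
    testing bound is the case of the test [1_A + 1/2] and its counterpart for the complement. *)

Section label_law.
Context {d : measure_display} {T : measurableType d} {R : realType}.

(** The label is obtained by thresholding an independent uniform variable at [eta], so that the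
    labelled law is a pushforward of a product measure and Tonelli computes its integrals without
    any kernel. *)
Definition label_draw (eta : {mfun T >-> R}) (z : T * measurableTypeR R)
  : T * bool := (z.1, z.2 < eta z.1).

Lemma measurable_label_draw (eta : {mfun T >-> R}) :
  measurable_fun setT (label_draw eta).
Proof.
apply/measurable_fun_pair => //=.
apply: measurable_fun_ltr => //=.
by apply: measurableT_comp.
Qed.

HB.instance Definition _ (eta : {mfun T >-> R}) :=
  isMeasurableFun.Build _ _ _ _ (label_draw eta) (measurable_label_draw eta).

Definition label_law (mu : probability T R) (eta : {mfun T >-> R})
  : probability (T * bool)%type R :=
  distribution (mu \x uniform_prob (@ltr01 R))%E (label_draw eta).

Variables (mu : probability T R) (eta : {mfun T >-> R}).
Hypothesis eta01 : forall x, 0 <= eta x <= 1.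

Lemma integral_label_law (F : (T * bool)%type -> \bar R) :
  measurable_fun [set: (T * bool)%type] F -> (forall z, 0 <= F z)%E ->
  (\int[label_law mu eta]_z F z =
   \int[mu]_x ((eta x)%:E * F (x, true) + (1 - eta x)%:E * F (x, false)))%E.
Proof.
move=> mF F0.
rewrite ge0_integral_distribution// fubini_tonelli1//; last first.
- by move=> x; exact: F0.
- by apply: measurableT_comp => //; exact: measurable_label_draw.
apply: eq_integral => x _; rewrite /fubini_F/label_draw/=.
have mFx : measurable_fun setT (fun u : measurableTypeR R => F (x, u < eta x)).
  apply: measurableT_comp => //; apply/measurable_fun_pair => //=.
  exact: measurable_fun_ltr.
rewrite integral_uniform//= subr0 invr1 mul1e.
have /andP[e0 e1] := eta01 x.
(* The uniform variable gives label 1 on the first piece, of length [eta x], and label 0 on the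
   second. *)
have -> : `[0%R, 1%R]%classic = `[0%R, eta x[ `|` `[eta x, 1%R] :> set R.
  apply/seteqP; split => u /=; rewrite !in_itv/=.
    move=> /andP[-> ->]; rewrite andbT; case: (ltP u (eta x)) => _; [left|right]; done.
  by case=> /andP[u0 u1]; apply/andP; split; lra.
rewrite ge0_integral_setU//=; last 2 first.
- exact: measurable_funTS.
- apply/disj_setPS => u /=; rewrite !in_itv/= => -[/andP[_ ?] /andP[? _]]; lra.
congr (_ + _)%E.
  rewrite (eq_integral (cst (F (x, true)))); last first.
    by move=> u; rewrite inE/= in_itv/= /label_draw/= => /andP[_ ->].
  rewrite integral_cst//= lebesgue_measure_itv/= lte_fin muleC; case: ltP => //.
    by rewrite sube0.
  by move=> h; congr (_%:E * _)%E; lra.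
rewrite (eq_integral (cst (F (x, false)))); last first.
  move=> u; rewrite inE/= in_itv/= /label_draw/= => /andP[+ _].
  by rewrite leNgt => /negbTE ->.
rewrite integral_cst//= lebesgue_measure_itv/= lte_fin muleC; case: ltP => //.
by move=> h; congr (_%:E * _)%E; lra.
Qed.

Lemma label_law_fst (A : set T) : measurable A ->
  label_law mu eta (fst @^-1` A) = mu A.
Proof.
move=> mA; have mfA : measurable (fst @^-1` A : set (T * bool)).
  by rewrite -[X in measurable X]setTI; exact: measurable_fst.
transitivity (\int[label_law mu eta]_z (\1_(fst @^-1` A) z)%:E)%E.
  by rewrite integral_indic// setIT.
rewrite (integral_label_law (fun z => (\1_(fst @^-1` A) z)%:E))//; last first.
  exact/measurable_EFinP.
transitivity (\int[mu]_x (\1_A x)%:E)%E; last by rewrite integral_indic// setIT.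
apply: eq_integral => x _.
have E b : \1_(fst @^-1` A) (x, b) = \1_A x :> R.
  by rewrite !indicE; congr (_%:R); apply/idP/idP; rewrite !inE.
by rewrite !E -!EFinM -EFinD; congr (_%:E); ring.
Qed.


Lemma label_law_setX1 (A : set T) : measurable A ->
  label_law mu eta (A `*` [set true]) = (\int[mu]_(x in A) (eta x)%:E)%E.
Proof.
move=> mA.
transitivity (\int[label_law mu eta]_z (\1_(A `*` [set true]) z)%:E)%E.
  by rewrite integral_indic// ?setIT//; exact: measurableX.
rewrite (integral_label_law (fun z => (\1_(A `*` [set true]) z)%:E))//; last first.
  by apply/measurable_EFinP/measurable_indic; exact: measurableX.
rewrite [RHS]integral_mkcond; apply: eq_integral => x _.
rewrite patchE !indicE; case: ifPn => [|]; rewrite ?inE ?notin_setE => Ax.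
  rewrite mem_set// memNset ?mule1 ?mule0 ?adde0//; first by case.
by rewrite !memNset ?mule0 ?adde0// => -[].
Qed.

End label_law.

(** * Hellinger affinity *)

Lemma mean_geomean2 {R : realFieldType} (D x y : R) :
  0 <= x -> 0 <= y -> D ^+ 2 <= x * y -> 2 * D <= x + y.
Proof.
move=> x0 y0 Dxy; have : (2 * D) ^+ 2 <= (x + y) ^+ 2.
  apply: (@le_trans _ _ (4 * (x * y))); first by rewrite exprMn -natrX ler_pM2l.
  by rewrite -subr_ge0 (_ : _ - _ = (x - y) ^+ 2) ?sqr_ge0//; ring.
by move=> h; have [D0|D0] := leP (2 * D) 0; [lra|rewrite -ler_sqr ?nnegrE; lra].
Qed.

(* Optimising [t] recovers Cauchy-Schwarz from the weighted AM-GM inequality. *)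
Lemma sqr_le_mul_of_weighted {R : realFieldType} (I J K : R) :
  0 <= I -> 0 <= J -> 0 <= K ->
  (forall t, 0 < t -> 2 * K <= t * I + t^-1 * J) -> K ^+ 2 <= I * J.
Proof.
move=> I0 J0; rewrite le_eqVlt => /predU1P[<- _|K0 H].
  by rewrite expr0n/= mulr_ge0.
have [Iz|Ip] := leP I 0.
  have Ie : I = 0 by lra.
  have t0 : 0 < (J + 1) / K by rewrite divr_gt0//; lra.
  have := H _ t0; rewrite Ie mulr0 add0r invf_div.
  have -> : K / (J + 1) * J = K * (J / (J + 1)) by field; lra.
  have h : J / (J + 1) <= 1 by rewrite ler_pdivrMr; lra.
  by have := ler_pM2l K0 (J / (J + 1)) 1; rewrite h mulr1; lra.
have := H (K / I) (divr_gt0 K0 Ip); rewrite invf_div divfK ?gt_eqF//.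
rewrite -mulrAC => h.
have {h}: K <= I * J / K by lra.
by rewrite ler_pdivlMr.
Qed.

Section affinity.
Context {R : realType}.

(* The squared Hellinger affinity of [mu] and [nu] is at least [k]: by
   Cauchy-Schwarz the inequality holds with [k] the square of the integral of
   the geometric mean of the densities. *)
Definition affinity_ge {d : measure_display} {T : measurableType d}
    (mu nu : set T -> \bar R) (k : R) :=
  forall (F G : T -> R) (D : R),
    measurable_fun setT F -> measurable_fun setT G ->
    (forall x, 0 <= F x <= 2) -> (forall x, 0 <= G x <= 2) ->
    0 <= D -> (forall x, D <= F x * G x) ->
    ((k * D)%:E <= (\int[mu]_x (F x)%:E) * (\int[nu]_x (G x)%:E))%E.

Lemma affinity_pushforward {d d' : measure_display} {T : measurableType d}
    {T' : measurableType d'} (mu nu : {measure set T -> \bar R})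
    (phi : T -> T') (k : R) : measurable_fun setT phi ->
  affinity_ge mu nu k -> affinity_ge (pushforward mu phi) (pushforward nu phi) k.
Proof.
move=> mphi munu F G D mF mG F2 G2 D0 DFG.
have [F0 G0] : (forall x, 0 <= F x) /\ (forall x, 0 <= G x).
  by split=> x; [case/andP: (F2 x)|case/andP: (G2 x)].
have E (m : {measure set T -> \bar R}) (H : T' -> R) : measurable_fun setT H ->
    (forall x, 0 <= H x) ->
    (\int[pushforward m phi]_x (H x)%:E = \int[m]_x (H (phi x))%:E)%E.
  move=> mH H0; rewrite (ge0_integral_pushforward mphi)//.
    exact/measurable_EFinP.
  by move=> x _; rewrite lee_fin.
rewrite (E mu)// (E nu)//.
by apply: munu => //; exact: measurableT_comp.
Qed.

Lemma bounded_integral_fin {d : measure_display} {T : measurableType d}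
    (mu : {measure set T -> \bar R}) (F : T -> R) (M : R) :
  0 < M -> (mu setT <= 1)%E -> measurable_fun setT F -> (forall x, 0 <= F x <= M) ->
  exists2 I : R, (\int[mu]_x (F x)%:E = I%:E)%E & 0 <= I <= M.
Proof.
move=> M0 mu1 mF FM.
have F0 x : 0 <= F x by case/andP: (FM x).
have h0 : (0 <= \int[mu]_x (F x)%:E)%E.
  by apply: integral_ge0 => x _; rewrite lee_fin.
have h1 : (\int[mu]_x (F x)%:E <= M%:E)%E.
  apply: (@le_trans _ _ (\int[mu]_x (cst M%:E) x)%E).
    apply: ge0_le_integral => //.
    - by move=> x _; rewrite lee_fin.
    - exact/measurable_EFinP.
    - by move=> x _; rewrite lee_fin; case/andP: (FM x).
  by rewrite integral_cst// -[leRHS]mule1 lee_pmul2l.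
have hf : (\int[mu]_x (F x)%:E)%E \is a fin_num.
  by rewrite ge0_fin_numE//; apply: le_lt_trans h1 _; rewrite ltry.
exists (fine (\int[mu]_x (F x)%:E)); first by rewrite fineK.
by rewrite -!lee_fin fineK// h0.
Qed.

(** Integrating out the second factor turns [F] and [G] into tests [f] and [g] on the first one:
    total mass at most 1 keeps the bound 2, and the affinity of the second pair gives
    [k2 * D <= f x * g x]. *)
Lemma affinity_prod {d1 d2 : measure_display} {T1 : measurableType d1}
    {T2 : measurableType d2}
    (mu1 nu1 : {sigma_finite_measure set T1 -> \bar R})
    (mu2 nu2 : {sigma_finite_measure set T2 -> \bar R}) (k1 k2 : R) :
  (mu2 setT <= 1)%E -> (nu2 setT <= 1)%E -> 0 <= k2 ->
  affinity_ge mu1 nu1 k1 -> affinity_ge mu2 nu2 k2 ->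
  affinity_ge (mu1 \x mu2)%E (nu1 \x nu2)%E (k1 * k2).
Proof.
move=> mu2_1 nu2_1 k20 A1 A2 F G D mF mG F2 G2 D0 DFG.
have F0 z : 0 <= F z by case/andP: (F2 z).
have G0 z : 0 <= G z by case/andP: (G2 z).
have mE (H : T1 * T2 -> R) : measurable_fun setT H ->
    measurable_fun setT (fun z => (H z)%:E) by move=> ?; exact/measurable_EFinP.
have msec (H : T1 * T2 -> R) x : measurable_fun setT H ->
    measurable_fun setT (fun y => H (x, y)) by move=> mH; exact: measurableT_comp.
rewrite (fubini_tonelli1 (fun z => (F z)%:E) (mE _ mF))//; last first.
rewrite (fubini_tonelli1 (fun z => (G z)%:E) (mE _ mG))//; last first.
pose f x := fine (\int[mu2]_y (F (x, y))%:E)%E.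
pose g x := fine (\int[nu2]_y (G (x, y))%:E)%E.
have fE x : (\int[mu2]_y (F (x, y))%:E = (f x)%:E)%E /\ 0 <= f x <= 2.
  have [I IE I2] := @bounded_integral_fin _ _ mu2 (fun y => F (x, y)) 2 ltac:(lra)
    mu2_1 (msec _ x mF) (fun y => F2 (x, y)).
  by rewrite /f IE.
have gE x : (\int[nu2]_y (G (x, y))%:E = (g x)%:E)%E /\ 0 <= g x <= 2.
  have [I IE I2] := @bounded_integral_fin _ _ nu2 (fun y => G (x, y)) 2 ltac:(lra)
    nu2_1 (msec _ x mG) (fun y => G2 (x, y)).
  by rewrite /g IE.
rewrite (eq_integral (fun x => (f x)%:E)); last first.
  by move=> x _; rewrite /fubini_F/= (fE x).1.
rewrite [X in (_ <= _ * X)%E](eq_integral (fun x => (g x)%:E)); last first.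
  by move=> x _; rewrite /fubini_F/= (gE x).1.
rewrite -mulrA; apply: A1.
- apply: measurableT_comp => //.
  exact: (measurable_fun_fubini_tonelli_F (fun z => (F z)%:E) (mE _ mF)).
- apply: measurableT_comp => //.
  exact: (measurable_fun_fubini_tonelli_F (fun z => (G z)%:E) (mE _ mG)).
- by move=> x; exact: (fE x).2.
- by move=> x; exact: (gE x).2.
- exact: mulr_ge0.
- move=> x; rewrite -lee_fin [leRHS]EFinM -(fE x).1 -(gE x).1.
  apply: A2 => //; exact: msec.
Qed.

Lemma affinity_tuple {d : measure_display} {T : measurableType d}
    (P Q : probability T R) (k : R) (n : nat) :
  0 <= k -> affinity_ge P Q k ->
  affinity_ge (tuple_measure P n) (tuple_measure Q n) (k ^+ n).
Proof.
move=> k0 PQ; elim: n => [|n IHn].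
  move=> F G D mF mG F2 G2 D0 DFG; rewrite /= expr0 mul1r.
  rewrite !integral_dirac//; last 2 first.
  - exact/measurable_EFinP.
  - exact/measurable_EFinP.
  by rewrite diracT !mul1e -EFinM lee_fin.
rewrite exprS; apply: affinity_pushforward.
  exact: (measurable_cons measurable_fst measurable_snd).
apply: affinity_prod => //; try by rewrite tuple_measure_probability.
exact: exprn_ge0.
Qed.

(** Le Cam's two-point bound: no test separates two measures of large affinity. The indicators of
    [A] and of its complement have product 0, so both are raised by 1/2 before the affinity is
    applied. *)
Lemma affinity_test {d : measure_display} {T : measurableType d}
    (mu nu : {measure set T -> \bar R}) (k : R) (A : set T) :
  (mu setT <= 1)%E -> (nu setT <= 1)%E ->
  1 / 2 <= k -> affinity_ge mu nu k -> measurable A ->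
  ((1 / 5)%:E <= mu A + nu (~` A))%E.
Proof.
move=> mu1 nu1 k2 munu mA.
have mAc : measurable (~` A) by exact: measurableC.
pose F (B : set T) x : R := \1_B x + 1 / 2.
have mF B : measurable B -> measurable_fun setT (F B).
  by move=> mB; apply: measurable_funD => //; exact: measurable_indic.
have F2 B x : 0 <= F B x <= 2 by rewrite /F indicE; case: (_ \in _) => /=; lra.
have FE (m : {measure set T -> \bar R}) B : measurable B ->
    (\int[m]_x (F B x)%:E = m B + (1 / 2)%:E * m setT)%E.
  move=> mB; rewrite (eq_integral (fun x => (\1_B x)%:E + (1 / 2)%:E)%E)//.
  rewrite ge0_integralD//; last exact/measurable_EFinP/measurable_indic.
  by rewrite integral_indic// setIT integral_cst.
(* One factor is 3/2 and the other 1/2, at every point. *)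
have FF x : 3 / 4 <= F A x * F (~` A) x.
  rewrite /F !indicE; have [Ax|Ax] := pselect (A x).
    by rewrite mem_set// memNset//=; lra.
  by rewrite memNset// mem_set//=; lra.
have := munu _ _ (3 / 4) (mF _ mA) (mF _ mAc) (F2 A) (F2 (~` A)) ltac:(lra) FF.
rewrite !FE//.
have fin (m : {measure set T -> \bar R}) B : (m setT <= 1)%E -> measurable B ->
    (m B <= 1)%E.
  by move=> m1 mB; apply: le_trans m1; apply: le_measure; rewrite ?inE.
have toR (m : {measure set T -> \bar R}) B : (m setT <= 1)%E -> measurable B ->
    exists2 x : R, m B = x%:E & 0 <= x <= 1.
  move=> m1 mB; have h1 := fin _ _ m1 mB; have h0 := measure_ge0 m B.
  have hf : m B \is a fin_num.
    by rewrite ge0_fin_numE//; apply: le_lt_trans h1 _; rewrite ltry.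
  by exists (fine (m B)); rewrite ?fineK// -!lee_fin fineK// h0.
have [x -> x01] := toR mu A mu1 mA.
have [y -> y01] := toR nu (~` A) nu1 mAc.
have [m -> m01] := toR mu setT mu1 measurableT.
have [n -> n01] := toR nu setT nu1 measurableT.
rewrite -?EFinM -?EFinD -?EFinM ?lee_fin => h.
(* The affinity gives at least [1/2 * 3/4 = 3/8], whereas a sum of errors below 1/5 bounds the
   product by [(3/5)^2 = 9/25], which is smaller. *)
rewrite leNgt; apply/negP => xy.
have : (x + 1 / 2 * m) * (y + 1 / 2 * n) <= (x + 1 / 2) * (y + 1 / 2).
  by apply: ler_pM; lra.
have : (x + 1 / 2) * (y + 1 / 2) <= ((x + y + 1) / 2) ^+ 2.
  by rewrite -subr_ge0 (_ : _ - _ = ((x - y) / 2) ^+ 2) ?sqr_ge0//; field.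
have : ((x + y + 1) / 2) ^+ 2 <= (3 / 5) ^+ 2 by rewrite ler_sqr ?nnegrE; lra.
lra.
Qed.

(** A Bernoulli law has affinity 1 with itself. In the expanded product the cross terms satisfy
    [F1 * G0 + F0 * G1 >= 2 * D] by AM-GM, since their product is [(F0 * G0) * (F1 * G1)]. *)
Lemma bernoulli_affinity_eq (u F0 F1 G0 G1 D : R) :
  0 <= u <= 1 -> 0 <= D -> 0 <= F0 -> 0 <= F1 -> 0 <= G0 -> 0 <= G1 ->
  D <= F0 * G0 -> D <= F1 * G1 ->
  D <= (u * F1 + (1 - u) * F0) * (u * G1 + (1 - u) * G0).
Proof.
move=> /andP[u0 u1] D0 F00 F10 G00 G10 D00 D11.
have h : 2 * D <= F1 * G0 + F0 * G1.
  apply: mean_geomean2; rewrite ?mulr_ge0//.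
  rewrite (_ : F1 * G0 * (F0 * G1) = (F0 * G0) * (F1 * G1)); last by ring.
  by rewrite expr2 ler_pM.
have e : (u * F1 + (1 - u) * F0) * (u * G1 + (1 - u) * G0) - D =
  u ^+ 2 * (F1 * G1 - D) + (1 - u) ^+ 2 * (F0 * G0 - D) +
  u * (1 - u) * (F1 * G0 + F0 * G1 - 2 * D) by ring.
by rewrite -subr_ge0 e !addr_ge0// mulr_ge0 ?exprn_ge0 ?mulr_ge0 ?subr_ge0.
Qed.

(** The factor [4 * u * (1 - u)] is the squared affinity of the Bernoulli laws of parameters [u] and
    [1 - u], namely the square of [2 * sqrt (u * (1 - u))]. *)
Lemma bernoulli_affinity_flip (u F0 F1 G0 G1 D : R) :
  0 <= u <= 1 -> 0 <= D -> 0 <= F0 -> 0 <= F1 -> 0 <= G0 -> 0 <= G1 ->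
  D <= F0 * G0 -> D <= F1 * G1 ->
  4 * u * (1 - u) * D <= (u * F1 + (1 - u) * F0) * ((1 - u) * G1 + u * G0).
Proof.
move=> /andP[u0 u1] D0 F00 F10 G00 G10 D00 D11.
have h : 2 * (u * (1 - u) * D) <= u ^+ 2 * (F1 * G0) + (1 - u) ^+ 2 * (F0 * G1).
  apply: mean_geomean2; rewrite ?mulr_ge0 ?exprn_ge0 ?subr_ge0//.
  rewrite (_ : u ^+ 2 * _ * _ = (u * (1 - u)) ^+ 2 * ((F0 * G0) * (F1 * G1))).
    rewrite exprMn ler_wpM2l ?exprn_ge0 ?mulr_ge0 ?subr_ge0// expr2.
    by rewrite ler_pM.
  by ring.
have e : (u * F1 + (1 - u) * F0) * ((1 - u) * G1 + u * G0) - 4 * u * (1 - u) * D =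
  u * (1 - u) * (F1 * G1 - D) + u * (1 - u) * (F0 * G0 - D) +
  (u ^+ 2 * (F1 * G0) + (1 - u) ^+ 2 * (F0 * G1) - 2 * (u * (1 - u) * D)) by ring.
have uu : 0 <= u * (1 - u) by rewrite mulr_ge0// subr_ge0.
rewrite -subr_ge0 e; apply: addr_ge0; last by rewrite subr_ge0.
by apply: addr_ge0; apply: mulr_ge0 => //; rewrite subr_ge0.
Qed.

(** Conditionally on the design point the labels have affinity 1 off [B] and at least
    [1 - 4 * h ^+ 2] on [B], so the affinity integrates to at least [1 - 4 * h ^+ 2 * w]; the
    constant is its square. Square roots of [f * g] are avoided by integrating a weighted AM-GM
    inequality and optimising the weight at the end. *)
Lemma affinity_label_law {d : measure_display} {T : measurableType d}
    (mu : probability T R) (eta1 eta2 : {mfun T >-> R}) (B : set T) (h w : R) :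
  (forall x, 0 <= eta1 x <= 1) -> (forall x, 0 <= eta2 x <= 1) ->
  measurable B -> (mu B <= w%:E)%E -> 0 <= h -> 4 * h ^+ 2 * w <= 1 ->
  4 * h ^+ 2 <= 1 ->
  (forall x, ~ B x -> eta1 x = eta2 x) ->
  (forall x, B x -> eta2 x = 1 - eta1 x /\ `|eta1 x - 1 / 2| <= h) ->
  affinity_ge (label_law mu eta1) (label_law mu eta2) ((1 - 4 * h ^+ 2 * w) ^+ 2).
Proof.
move=> e1 e2 mB muB h0 hw h1 eNB eB F G D mF mG F2 G2 D0 DFG.
have F0 z : 0 <= F z by case/andP: (F2 z).
have G0 z : 0 <= G z by case/andP: (G2 z).
pose f x := eta1 x * F (x, true) + (1 - eta1 x) * F (x, false).
pose g x := eta2 x * G (x, true) + (1 - eta2 x) * G (x, false).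
have mlab (eta : {mfun T >-> R}) (H : (T * bool)%type -> R) :
    measurable_fun [set: (T * bool)%type] H ->
    measurable_fun setT
      (fun x => eta x * H (x, true) + (1 - eta x) * H (x, false)).
  move=> mH; apply: measurable_funD; apply: measurable_funM => //.
  - exact: measurableT_comp.
  - exact: measurable_funB.
  - exact: measurableT_comp.
have b2 (eta : {mfun T >-> R}) (H : (T * bool)%type -> R) :
    (forall x, 0 <= eta x <= 1) -> (forall z, 0 <= H z <= 2) -> forall x,
    0 <= eta x * H (x, true) + (1 - eta x) * H (x, false) <= 2.
  move=> he hH x; have /andP[a0 a1] := he x.
  have /andP[b0 b1] := hH (x, true); have /andP[c0 c1] := hH (x, false).
  apply/andP; split; first by rewrite addr_ge0// mulr_ge0// subr_ge0.
  have : eta x * H (x, true) <= eta x * 2 by exact: ler_wpM2l.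
  have : (1 - eta x) * H (x, false) <= (1 - eta x) * 2.
    by apply: ler_wpM2l => //; lra.
  lra.
have LE (eta : {mfun T >-> R}) (H : (T * bool)%type -> R) :
    (forall x, 0 <= eta x <= 1) -> measurable_fun [set: (T * bool)%type] H ->
    (forall z, 0 <= H z) ->
    (\int[label_law mu eta]_z (H z)%:E =
     \int[mu]_x (eta x * H (x, true) + (1 - eta x) * H (x, false))%:E)%E.
  move=> he mH H0.
  rewrite (integral_label_law mu eta he (fun z => (H z)%:E))//.
  exact/measurable_EFinP.
suff key : (((1 - 4 * h ^+ 2 * w) ^+ 2 * D)%:E <=
    (\int[mu]_x (f x)%:E) * (\int[mu]_x (g x)%:E))%E.
  apply: (le_trans key); rewrite le_eqVlt; apply/orP; left; apply/eqP.
  by congr (_ * _)%E; apply/esym; [exact: LE|exact: LE].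
have mu1 : (mu setT <= 1)%E by rewrite probability_setT.
have [I IE /andP[I0 _]] := @bounded_integral_fin _ _ mu f 2 ltac:(lra) mu1
  (mlab _ _ mF) (b2 _ _ e1 F2).
have [J JE /andP[J0 _]] := @bounded_integral_fin _ _ mu g 2 ltac:(lra) mu1
  (mlab _ _ mG) (b2 _ _ e2 G2).
rewrite IE JE -EFinM lee_fin.
set s := Num.sqrt D; have s0 : 0 <= s by exact: sqrtr_ge0.
have sD : D = s ^+ 2 by rewrite sqr_sqrtr.
rewrite sD -exprMn; apply: sqr_le_mul_of_weighted => //.
  by rewrite mulr_ge0// subr_ge0.
have f0 x : 0 <= f x by case/andP: (b2 _ _ e1 F2 x).
have g0 x : 0 <= g x by case/andP: (b2 _ _ e2 G2 x).
move=> t t0.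
have ti0 : 0 < t^-1 by rewrite invr_gt0.
(* The last term is the defect on [B]: there AM-GM only yields [2 * (1 - 4 * h ^+ 2) * s]. *)
have ptw x : 2 * s <= t * f x + t^-1 * g x + 8 * h ^+ 2 * s * \1_B x.
  have fgE : (t * f x) * (t^-1 * g x) = f x * g x by field; rewrite gt_eqF.
  have tf0 : 0 <= t * f x by rewrite mulr_ge0// ltW.
  have tg0 : 0 <= t^-1 * g x by rewrite mulr_ge0// ltW.
  have [Bx|NBx] := pselect (B x); rewrite indicE.
    rewrite mem_set// mulr1.
    have [eE he] := eB _ Bx.
    suff : 2 * ((1 - 4 * h ^+ 2) * s) <= t * f x + t^-1 * g x by lra.
    apply: mean_geomean2 => //; rewrite fgE exprMn -sD.
    apply: (@le_trans _ _ (4 * eta1 x * (1 - eta1 x) * D)).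
      apply: ler_wpM2r => //.
      have : (eta1 x - 1 / 2) ^+ 2 <= h ^+ 2.
        by rewrite -real_normK ?num_real// ler_sqr ?nnegrE.
      have -> : 4 * eta1 x * (1 - eta1 x) = 1 - 4 * (eta1 x - 1 / 2) ^+ 2.
        by field.
      (* The sharp constant would be [sqrt (1 - 4 * h ^+ 2)]; the weaker [1 - 4 * h ^+ 2] keeps
         everything polynomial. *)
      have : (1 - 4 * h ^+ 2) ^+ 2 <= 1 - 4 * h ^+ 2.
        by rewrite expr2 ler_piMl ?subr_ge0// lerBlDr lerDl mulr_ge0// sqr_ge0.
      lra.
    have := @bernoulli_affinity_flip (eta1 x) _ _ _ _ D (e1 x) D0
      (F0 (x, false)) (F0 (x, true)) (G0 (x, false)) (G0 (x, true)) (DFG _) (DFG _).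
    by rewrite /f /g eE subKr.
  rewrite memNset// mulr0 addr0; apply: mean_geomean2 => //.
  rewrite fgE -sD /f /g -(eNB _ NBx).
  exact: bernoulli_affinity_eq.
have mf : measurable_fun setT (EFin \o f) by exact/measurable_EFinP/mlab.
have mg : measurable_fun setT (EFin \o g) by exact/measurable_EFinP/mlab.
have h80 : 0 <= 8 * h ^+ 2 * s by rewrite !mulr_ge0// exprn_ge0.
have /fineK muBE : mu B \is a fin_num by exact: fin_num_measure.
set b := fine (mu B) in muBE.
have : (\int[mu]_(x in setT) (cst (2 * s)%:E x) <=
    \int[mu]_x (t%:E * (f x)%:E + (t^-1)%:E * (g x)%:E +
                (8 * h ^+ 2 * s)%:E * (\1_B x)%:E))%E.
  apply: ge0_le_integral => //.
  - by move=> x _; rewrite lee_fin mulr_ge0.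
  - apply: emeasurable_funD; first apply: emeasurable_funD.
    + exact: measurable_funeM.
    + exact: measurable_funeM.
    + by apply: measurable_funeM; exact/measurable_EFinP/measurable_indic.
  - by move=> x _; rewrite -!EFinM -!EFinD lee_fin; exact: ptw.
rewrite integral_cst//= probability_setT mule1.
have mB' : measurable_fun setT (fun x => (\1_B x)%:E : \bar R).
  exact/measurable_EFinP/measurable_indic.
rewrite ge0_integralD//; first last.
- exact: measurable_funeM.
- by move=> x _; rewrite -EFinM lee_fin mulr_ge0.
- by apply: emeasurable_funD; exact: measurable_funeM.
- by move=> x _; rewrite -!EFinM -EFinD lee_fin addr_ge0// mulr_ge0// ltW.
rewrite ge0_integralD//; first last.
- exact: measurable_funeM.
- by move=> x _; rewrite -EFinM lee_fin mulr_ge0// ltW.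
- exact: measurable_funeM.
- by move=> x _; rewrite -EFinM lee_fin mulr_ge0// ltW.
rewrite !ge0_integralZl//; try by [move=> x _; rewrite lee_fin | rewrite lee_fin ltW].
have BE : (\int[mu]_x (\1_B x)%:E = b%:E)%E.
  by rewrite integral_indic// setIT; exact: esym muBE.
rewrite IE JE BE -!EFinM -!EFinD lee_fin => H.
have bw : b <= w by rewrite -lee_fin muBE.
have : 8 * h ^+ 2 * s * b <= 8 * h ^+ 2 * s * w by exact: ler_wpM2l.
lra.
Qed.

End affinity.

(** * Risk and Bayes classifier *)

Section risk.
Context {R : realType} {d : nat}.
Local Notation point := (@Defs.point R d).
Local Notation obs := (@obs R d).

Definition fst_obs : obs -> point := fst.

Lemma measurable_fst_obs : measurable_fun [set: obs] fst_obs.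
Proof. exact: measurable_fst. Qed.

HB.instance Definition _ :=
  isMeasurableFun.Build _ _ _ _ fst_obs measurable_fst_obs.

Definition marginal_probability (P : probability obs R) : probability point R :=
  distribution P fst_obs.

Local Notation marg := marginal_probability.

Lemma marginal_probabilityE (P : probability obs R) : marginal P = marg P.
Proof. by []. Qed.

Lemma measurable_setX_bool (A : set point) (b : bool) :
  measurable A -> measurable (A `*` [set b] : set obs).
Proof. by move=> mA; exact: measurableX. Qed.

Lemma regression_setX0 (Q : probability obs R) (eta : point -> R) (A : set point) :
  is_regression Q eta -> measurable A ->
  Q (A `*` [set false]) = (\int[marg Q]_(x in A) (1 - eta x)%:E)%E.
Proof.
move=> [meta eta01 etaE] mA.
have mAE : (marg Q A = Q (A `*` [set true]) + Q (A `*` [set false]))%E.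
  rewrite -measureU; [|exact: measurable_setX_bool|exact: measurable_setX_bool|].
    congr (Q _); apply/seteqP; split => -[x b] /=.
      by rewrite /preimage/=; case: b => Ax; [left|right].
    by case=> -[].
  by apply/seteqP; split => -[x b] //= -[[_ ->] []].
have e0 x : 0 <= eta x by case/andP: (eta01 x).
have e1 x : 0 <= 1 - eta x by rewrite subr_ge0; case/andP: (eta01 x).
have me1 : measurable_fun A (fun x => (1 - eta x)%:E).
  by apply/measurable_EFinP; apply: measurable_funB => //; exact: measurable_funTS.
have me : measurable_fun A (fun x => (eta x)%:E).
  by apply/measurable_EFinP; exact: measurable_funTS.
have : (marg Q A = \int[marg Q]_(x in A) (eta x)%:E +
                   \int[marg Q]_(x in A) (1 - eta x)%:E)%E.
  rewrite -ge0_integralD//; last 2 first.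
  - by move=> x _; rewrite lee_fin.
  - by move=> x _; rewrite lee_fin.
  rewrite (eq_integral (cst 1%E)); first by rewrite integral_cst// mul1e.
  by move=> x _; rewrite -EFinD addrC subrK.
rewrite mAE etaE//.
have : (\int[marg Q]_(x in A) (eta x)%:E)%E \is a fin_num.
  rewrite -[X in X \is a _]etaE//; apply: fin_num_measure.
  exact: measurable_setX_bool.
move=> fin /(congr1 (fun u => u - \int[marg Q]_(x in A) (eta x)%:E)%E).
by rewrite [X in (X - _)%E]addeC [X in _ = (X - _)%E]addeC !addeK.
Qed.

Lemma measurable_fun_bool_set (f : point -> bool) (b : bool) :
  measurable_fun setT f -> measurable [set x | f x = b].
Proof.
move=> mf; rewrite [X in measurable X](_ : _ = setT `&` f @^-1` [set b]).
  exact: mf.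
by rewrite setTI.
Qed.

Lemma risk_regression (Q : probability obs R) (eta : point -> R)
    (f : point -> bool) :
  is_regression Q eta -> measurable_fun setT f ->
  risk Q f = (\int[marg Q]_x (if f x then 1 - eta x else eta x)%:E)%E.
Proof.
move=> Qeta mf; have [meta eta01 etaE] := Qeta.
pose A b : set point := [set x | f x = b].
have mA b : measurable (A b) by exact: measurable_fun_bool_set.
have -> : risk Q f = (Q (A true `*` [set false]) + Q (A false `*` [set true]))%E.
  rewrite -measureU; [|exact: measurable_setX_bool|exact: measurable_setX_bool|].
    congr (Q _); apply/seteqP; split => -[x b] /=; rewrite /A/=.
      by case: b; case: (f x) => //= _; [right|left].
    by case=> -[-> ->].
  by apply/seteqP; split => -[x b] //= -[[_ ->] []].
rewrite (regression_setX0 _ eta)// etaE//.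
have TE : [set: point] = A true `|` A false.
  by apply/seteqP; split => x _ //; rewrite /A/=; case: (f x); [left|right].
have mif : measurable_fun setT (fun x => (if f x then 1 - eta x else eta x)%:E).
  apply/measurable_EFinP; apply: measurable_fun_ifT => //.
  exact: measurable_funB.
rewrite [in RHS]TE ge0_integral_setU//; last 3 first.
- by rewrite -TE.
- by move=> x _; rewrite lee_fin; have := eta01 x; case: ifP => _; lra.
- by apply/disj_setPS => x []; rewrite /A/= => ->.
rewrite marginal_probabilityE; congr (_ + _)%E; apply: eq_integral => x;
  by rewrite inE /A/= => ->.
Qed.

(** [bayes] is built from an arbitrarily chosen version of the regression function. Expressing both
    risks through that same version makes the comparison pointwise. It allows an explicit classifier
    to replace [bayes] when the excess risk is bounded from below. *)
Lemma bayes_risk_le (Q : probability obs R) (eta : point -> R)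
    (f : point -> bool) :
  is_regression Q eta -> measurable_fun setT f ->
  (risk Q (bayes Q) <= risk Q f)%E.
Proof.
move=> Qeta mf.
(* [regression] would be the default [cst 0] if no version existed; [eta] rules this out. *)
have Qr : is_regression Q (regression Q).
  by rewrite /regression; apply: xgetPex; exists eta.
have [mr r01 _] := Qr.
have mb : measurable_fun setT (bayes Q) by exact: measurable_fun_ler.
rewrite !(risk_regression _ _ _ Qr)//.
apply: ge0_le_integral => //.
- by move=> x _; rewrite lee_fin; have := r01 x; case: ifP => _; lra.
- apply/measurable_EFinP; apply: measurable_fun_ifT => //.
  exact: measurable_funB.
- apply/measurable_EFinP; apply: measurable_fun_ifT => //.
  exact: measurable_funB.
move=> x _; rewrite lee_fin /bayes; have /andP[? ?] := r01 x.
by case: (leP (1 / 2) (regression Q x)) => h; case: (f x); lra.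
Qed.

(** A wrong label at [x] costs [|2 * eta x - 1|] more than the right one, hence at least [2 * h] on
    [B]. The sign hypothesis says that [f'] always takes the cheaper label, so disagreements off [B]
    can only raise the risk of [f]. *)
Lemma risk_gap (Q : probability obs R) (eta : point -> R)
    (f f' : point -> bool) (B : set point) (h : R) :
  is_regression Q eta -> measurable_fun setT f -> measurable_fun setT f' ->
  measurable B -> 0 <= h ->
  (forall x, 0 <= (if f' x then 1 else -1) * (eta x - 1 / 2)) ->
  (forall x, B x -> h <= `|eta x - 1 / 2|) ->
  (risk Q f' + (2 * h)%:E * marg Q (B `&` [set x | f x != f' x]) <= risk Q f)%E.
Proof.
move=> Qeta mf mf' mB h0 sgn hB; have [meta eta01 etaE] := Qeta.
set E := B `&` _.
have mE : measurable E.
  apply: measurableI => //.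
  rewrite [X in measurable X](_ : _ =
    ([set x | f x = true] `&` [set x | f' x = false]) `|`
    ([set x | f x = false] `&` [set x | f' x = true])).
    by apply: measurableU; apply: measurableI; exact: measurable_fun_bool_set.
  apply/seteqP; split => x /=.
    by case: (f x); case: (f' x) => // _; [left|right].
  by case=> -[-> ->].
have mif (g : point -> bool) : measurable_fun setT g ->
    measurable_fun setT (fun x => (if g x then 1 - eta x else eta x)%:E).
  move=> mg; apply/measurable_EFinP; apply: measurable_fun_ifT => //.
  exact: measurable_funB.
have if0 (g : point -> bool) x : 0 <= (if g x then 1 - eta x else eta x).
  by have := eta01 x; case: ifP => _; lra.
rewrite !(risk_regression _ _ _ Qeta)//.
rewrite -(setIT E) -integral_indic// -ge0_integralZl//; last 2 first.
- exact/measurable_EFinP/measurable_indic.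
- by rewrite lee_fin mulr_ge0.
rewrite -ge0_integralD//; last 4 first.
- by move=> x _; rewrite lee_fin.
- exact: mif.
- by move=> x _; rewrite -EFinM lee_fin !mulr_ge0.
- by apply: measurable_funeM; exact/measurable_EFinP/measurable_indic.
apply: ge0_le_integral => //.
- by move=> x _; rewrite adde_ge0// ?lee_fin// !mulr_ge0.
- apply: emeasurable_funD; first exact: mif.
  by apply: measurable_funeM; exact/measurable_EFinP/measurable_indic.
- exact: mif.
move=> x _; rewrite -EFinM -EFinD lee_fin indicE.
have [Ex|NEx] := pselect (E x).
  rewrite mem_set// mulr1; case: Ex => Bx /= ne.
  have := hB x Bx; have := sgn x; move: ne.
  case: (f x); case: (f' x) => //= _ s; rewrite ler_normr => /orP[] ?; lra.
rewrite memNset// mulr0 addr0.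
have := sgn x; case: (f x); case: (f' x) => //=; rewrite ?mul1r ?mulN1r; try lra.
all: have := eta01 x; lra.
Qed.

End risk.

(** * Assouad's lemma *)

(* Prevents unification from unfolding the law down to product measures. *)
Opaque label_law.

Section flip.
Context {J : finType}.
Implicit Types (s : {ffun J -> bool}) (j : J).

Definition flip j s : {ffun J -> bool} := [ffun i => (i == j) (+) s i].

Lemma flipK j : involutive (flip j).
Proof. by move=> s; apply/ffunP => i; rewrite !ffunE addKb. Qed.

Lemma flip_at j s : flip j s j = ~~ s j.
Proof. by rewrite ffunE eqxx. Qed.

Lemma flip_neq j i s : i != j -> flip j s i = s i.
Proof. by rewrite ffunE => /negbTE ->. Qed.

(** Flipping one coordinate permutes the sign patterns, so summing the hypothesis over all of them
    counts the sum of [g] twice. *)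
Lemma sum_flip_ge {R : realFieldType} (g : {ffun J -> bool} -> R) (j : J) (e : R) :
  (forall s, e <= g s + g (flip j s)) ->
  #|{: {ffun J -> bool}}|%:R * (e / 2) <= \sum_s g s.
Proof.
move=> ge; have E : \sum_s g s = \sum_s g (flip j s).
  by rewrite [LHS](reindex_inj (inv_inj (flipK j))).
have : \sum_(s : {ffun J -> bool}) e <= \sum_s (g s + g (flip j s)).
  exact: ler_sum.
rewrite big_split/= -E sumr_const -mulr_natl; lra.
Qed.

End flip.

Section sample_probability.
Context {R : realType} {d : nat}.
Variables (P Q : probability (obs R d) R) (nP nQ : nat).
Local Open Scope ereal_scope.

(** The same product as [sample_law], named anew to carry the structure of a probability; the two
    are identified by conversion when the excess risk is unfolded. *)
Definition sample_probability := tuple_measure P nP \x tuple_measure Q nQ.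

HB.instance Definition _ := Measure.on sample_probability.

Let sample_probability_setT : sample_probability setT = 1.
Proof.
rewrite /sample_probability -setXTT product_measure1E//.
by rewrite [X in _ * X]tuple_measure_probability mule1; exact: tuple_measure_probability.
Qed.

HB.instance Definition _ :=
  Measure_isProbability.Build _ _ _ sample_probability sample_probability_setT.

End sample_probability.

Section label_law_regression.
Context {R : realType} {d : nat}.
Variables (mu : probability (Defs.point R d) R) (eta : {mfun Defs.point R d >-> R}).
Hypothesis eta01 : forall x, 0 <= eta x <= 1.

Lemma marginal_label_law (A : set (Defs.point R d)) :
  measurable A -> marginal (label_law mu eta) A = mu A.
Proof. exact: label_law_fst. Qed.

Lemma integral_marginal_label_law (A : set (Defs.point R d))
    (g : Defs.point R d -> \bar R) : measurable A ->
  (\int[marginal (label_law mu eta)]_(x in A) g x = \int[mu]_(x in A) g x)%E.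
Proof.
move=> mA; rewrite marginal_probabilityE.
apply: eq_measure_integral => //= C mC _.
exact: marginal_label_law.
Qed.

Lemma label_law_is_regression : is_regression (label_law mu eta) eta.
Proof.
split => // A mA.
by rewrite integral_marginal_label_law// label_law_setX1.
Qed.

End label_law_regression.

Lemma integral_probability_cstD {d : measure_display} {T : measurableType d}
    {R : realType} (P : probability T R) (c : \bar R) (g : T -> \bar R) :
  (0 <= c)%E -> measurable_fun setT g -> (forall x, 0 <= g x)%E ->
  (\int[P]_x (c + g x) = c + \int[P]_x g x)%E.
Proof.
move=> c0 mg g0; rewrite ge0_integralD// integral_cst//.
by rewrite [X in (_ * X + _)%E]probability_setT mule1.
Qed.

Section assouad.
Context {R : realType} {d : nat} {J : finType}.
Local Notation point := (@Defs.point R d).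
Local Notation obs := (@obs R d).
Variables (nP nQ : nat) (mu : probability point R) (cell : point -> J).
Variables (etaP etaQ : {ffun J -> bool} -> {mfun point >-> R}).
Variables (B : set point) (best : {ffun J -> bool} -> point -> bool).
Variables (h kP kQ : R).
Hypothesis mcell : forall j, measurable [set x | cell x = j].
Hypothesis mB : measurable B.
Hypothesis mbest : forall s, measurable_fun setT (best s).
Hypothesis bestE : forall s x, B x -> best s x = s (cell x).
Hypothesis h0 : 0 <= h.
Hypothesis eta01 : forall s x, 0 <= etaQ s x <= 1.
Hypothesis eta_best : forall s x,
  0 <= (if best s x then 1 else -1) * (etaQ s x - 1 / 2).
Hypothesis eta_gap : forall s x, B x -> h <= `|etaQ s x - 1 / 2|.

Let PP s : probability obs R := label_law mu (etaP s).
Let QQ s : probability obs R := label_law mu (etaQ s).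

Hypothesis kP0 : 0 <= kP.
Hypothesis kQ0 : 0 <= kQ.
Hypothesis affP : forall s j, affinity_ge (PP s) (PP (flip j s)) kP.
Hypothesis affQ : forall s j, affinity_ge (QQ s) (QQ (flip j s)) kQ.
Hypothesis k2 : 1 / 2 <= kP ^+ nP * kQ ^+ nQ.

Let L s : probability (nP.-tuple obs * nQ.-tuple obs)%type R :=
  sample_probability (PP s) (QQ s) nP nQ.

Lemma affinity_sample s j : affinity_ge (L s) (L (flip j s)) (kP ^+ nP * kQ ^+ nQ).
Proof.
apply: affinity_prod.
- by rewrite tuple_measure_probability.
- by rewrite tuple_measure_probability.
- exact: exprn_ge0.
- exact: affinity_tuple.
- exact: affinity_tuple.
Qed.

Variable f : classifier R d nP nQ.

Lemma measurable_classifier_section x :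
  measurable_fun setT (fun S => f (S, x)).
Proof. by apply: measurableT_comp => //; exact: measurable_pair2. Qed.

Let wrong s (x : point) : set (sample R d nP nQ) :=
  [set S | f (S, x) != s (cell x)].

Lemma measurable_wrong s x : measurable (wrong s x).
Proof.
rewrite [X in measurable X](_ : _ = [set S | f (S, x) = ~~ s (cell x)]).
  rewrite [X in measurable X](_ : _ =
    setT `&` (fun S => f (S, x)) @^-1` [set ~~ s (cell x)]); last by rewrite setTI.
  exact: measurable_classifier_section.
by apply/seteqP; split => S; rewrite /wrong/=; case: (f _); case: (s _).
Qed.

Let err s x : R := fine (L s (wrong s x)).

Lemma errE s x : (err s x)%:E = L s (wrong s x).
Proof.
rewrite fineK// ge0_fin_numE//; apply: (@le_lt_trans _ _ (L s setT)).
  by apply: le_measure; rewrite ?inE//; exact: measurable_wrong.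
by rewrite probability_setT ltry.
Qed.

(** Flipping the sign of the cell of [x] reverses the target label at [x], so the two error events
    are complementary in sample space: together they are one test between two hypotheses of affinity
    at least 1/2. *)
Lemma err_flip s x : 1 / 5 <= err s x + err (flip (cell x) s) x.
Proof.
rewrite -lee_fin EFinD !errE.
have -> : wrong (flip (cell x) s) x = ~` wrong s x.
  apply/seteqP; split => S; rewrite /wrong/= flip_at;
    by case: (f _); case: (s _).
apply: affinity_test k2 (affinity_sample s (cell x)) _.
- exact: probability_le1.
- exact: probability_le1.
- exact: measurable_wrong.
Qed.

(** Two choices of [D] are used: [B] for the errors that are charged, and [setT] to obtain the
    measurability of [err s] from that of sections. *)
Let bad_on (D : set point) s : set (sample R d nP nQ * point) :=
  [set z | D z.2 /\ f z != s (cell z.2)].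
Let bad := bad_on B.

Lemma measurable_bad_on D s : measurable D -> measurable (bad_on D s).
Proof.
move=> mD.
rewrite [X in measurable X](_ : _ =
  \bigcup_(j in [set: J]) ((snd @^-1` (D `&` [set x | cell x = j])) `&`
     f @^-1` [set ~~ s j])).
  apply: fin_bigcup_measurable => // j _; apply: measurableI.
    rewrite -[X in measurable X]setTI.
    by apply: measurable_snd => //; exact: measurableI.
  by rewrite -[X in measurable X]setTI; exact: measurable_funP.
apply/seteqP; split => -[S x]; rewrite /bad_on/=.
  move=> [Bx ne]; exists (cell x) => //; split => //=.
  by move: ne; case: (f _); case: (s _).
by move=> [j _ [[/= Bx <-] ->]]; split => //; case: (s _).
Qed.

Lemma measurable_bad s : measurable (bad s).
Proof. exact: measurable_bad_on. Qed.

Lemma measurable_err s : measurable_fun setT (err s).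
Proof.
apply: measurableT_comp => //.
rewrite (_ : (fun x => _) = L s \o ysection (bad_on setT s)).
  by apply: measurable_fun_ysection; exact: measurable_bad_on.
apply/funext => x /=; congr (L s _); apply/seteqP.
by split => S; rewrite /ysection/wrong/bad_on/= inE/=; tauto.
Qed.


(** Tonelli: the expected mass of misclassified points equals the integral over points of the error
    probability, which is what the pointwise testing bound controls. *)
Lemma integral_err s :
  (\int[L s]_S mu (xsection (bad s) S) = \int[mu]_(x in B) (err s x)%:E)%E.
Proof.
transitivity (\int[L s]_S \int[mu]_x (\1_(bad s) (S, x))%:E)%E.
  apply: eq_integral => S _.
  rewrite -(setIT (xsection (bad s) S)) -integral_indic//; last first.
    exact: measurable_xsection (measurable_bad s).
  apply: eq_integral => x _; rewrite !indicE; congr (_%:R%:E).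
  by rewrite -mem_xsection.
rewrite (fubini_tonelli (fun z => (\1_(bad s) z)%:E))//; last first.
  apply/measurable_EFinP. apply: measurable_indic. exact: measurable_bad.
rewrite [RHS]integral_mkcond; apply: eq_integral => x _; rewrite patchE errE.
case: ifPn => [|]; rewrite ?inE ?notin_setE => Bx.
  rewrite -(setIT (wrong s x)) -integral_indic//; last exact: measurable_wrong.
  apply: eq_integral => S _; rewrite !indicE; congr (_%:R%:E).
  by congr nat_of_bool; apply/idP/idP; rewrite !inE /bad/bad_on/wrong/=; [case|].
rewrite (eq_integral (cst 0%E)) ?integral0//.
by move=> S _; rewrite indicE memNset// /bad/bad_on/= => -[].
Qed.


Lemma measurable_risk s :
  measurable_fun setT (fun S => risk (QQ s) (fun x => f (S, x))).
Proof.
pose E : set ((nP.-tuple obs * nQ.-tuple obs)%type * obs) :=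
  [set z | f (z.1, z.2.1) != z.2.2].
have mE : measurable E.
  have mg : measurable_fun setT
      (fun z : (nP.-tuple obs * nQ.-tuple obs)%type * obs => f (z.1, z.2.1)).
    apply: measurableT_comp => //; apply/measurable_fun_pair => //=.
    exact: measurableT_comp measurable_fst measurable_snd.
  have ml : measurable_fun setT
      (fun z : (nP.-tuple obs * nQ.-tuple obs)%type * obs => z.2.2).
    exact: measurableT_comp measurable_snd measurable_snd.
  have ms b : measurable [set z : (nP.-tuple obs * nQ.-tuple obs)%type * obs |
      f (z.1, z.2.1) = b /\ z.2.2 = ~~ b].
    rewrite -[X in measurable X]setTI -[X in _ `&` X]/(
      (fun z : (nP.-tuple obs * nQ.-tuple obs)%type * obs => f (z.1, z.2.1)) @^-1` [set b]
      `&` (fun z : (nP.-tuple obs * nQ.-tuple obs)%type * obs => z.2.2) @^-1` [set ~~ b]).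
    rewrite setIIr; apply: measurableI; [exact: mg|exact: ml].
  rewrite [X in measurable X](_ : _ =
    [set z | f (z.1, z.2.1) = true /\ z.2.2 = ~~ true] `|`
    [set z | f (z.1, z.2.1) = false /\ z.2.2 = ~~ false]).
    exact: measurableU.
  apply/seteqP; split => -[S [x b]]; rewrite /E/=.
    by case: (f _); case: b => // _; [left|right].
  by case=> -[-> ->].
rewrite (_ : (fun S => _) = QQ s \o xsection E).
  exact: measurable_fun_xsection.
apply/funext => S /=; rewrite /risk; congr (QQ s _).
apply/seteqP; split => z; rewrite /xsection/= inE//.
Qed.

(** The Bayes risk is at most that of [best s], so the excess over the latter is a lower bound. For
    each fixed sample it is at least [2 * h] times the mass of the misclassified part of [B];
    integrating over samples gives [integral_err]. *)
Lemma excess_risk_ge s :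
  ((2 * h)%:E * \int[mu]_(x in B) (err s x)%:E <= excess_risk f (PP s, QQ s))%E.
Proof.
have regQ : is_regression (QQ s) (etaQ s) by exact: label_law_is_regression.
have bf (g : point -> bool) : measurable_fun setT g ->
    risk (QQ s) g \is a fin_num.
  move=> mg; rewrite (risk_regression _ _ _ regQ)//.
  have [|||I -> _] := @bounded_integral_fin _ _ _ (marginal_probability (QQ s))
     (fun x => if g x then 1 - etaQ s x else etaQ s x) 1 ltr01.
  - exact: probability_le1.
  - by apply: measurable_fun_ifT => //; exact: measurable_funB.
  - by move=> x; have := eta01 s x; case: ifP => _; lra.
  by [].
have mf S : measurable_fun setT (fun x => f (S, x)).
  by apply: measurableT_comp => //; exact: measurable_pair1.
have ptw S : (risk (QQ s) (best s) + (2 * h)%:E * mu (xsection (bad s) S) <=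
    risk (QQ s) (fun x => f (S, x)))%E.
  have := risk_gap _ _ _ _ _ _ regQ (mf S) (mbest s) mB h0 (eta_best s) (@eta_gap s).
  have -> : B `&` [set x | f (S, x) != best s x] = xsection (bad s) S.
    apply/seteqP; split => x; rewrite /xsection/= ?inE.
      by move=> [Bx ne]; split => //; rewrite -bestE.
    by move=> [Bx ne]; split => //=; rewrite bestE.
  rewrite -marginal_probabilityE marginal_label_law//.
  exact: measurable_xsection (measurable_bad s).
have mxs : measurable_fun setT (fun S => mu (xsection (bad s) S)).
  exact: (measurable_fun_xsection mu (measurable_bad s)).
have b0 : (0 <= risk (QQ s) (best s))%E by exact: measure_ge0.
have h2 : (0 <= (2 * h)%:E)%E by rewrite lee_fin mulr_ge0.
have -> : excess_risk f (PP s, QQ s) =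
    (\int[L s]_S risk (QQ s) (fun x => f (S, x)) - risk (QQ s) (bayes (QQ s)))%E.
  by [].
have bayes_le : (risk (QQ s) (bayes (QQ s)) <= risk (QQ s) (best s))%E.
  exact: bayes_risk_le regQ (mbest s).
have bfin : risk (QQ s) (best s) \is a fin_num by exact: bf.
(* Moving a term across an extended-real inequality requires it to be finite; here it lies below a
   finite risk. *)
rewrite leeBrDr; last first.
  rewrite ge0_fin_numE; last exact: measure_ge0.
  by apply: (le_lt_trans bayes_le); rewrite -ge0_fin_numE.
apply: (@le_trans _ _ (\int[L s]_S (risk (QQ s) (best s) +
    (2 * h)%:E * mu (xsection (bad s) S)))%E).
  rewrite integral_probability_cstD//; last 2 first.
  - exact: measurable_funeM.
  - by move=> S; rewrite mule_ge0.
  by rewrite ge0_integralZl// integral_err addeC leeD.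
apply: ge0_le_integral.
- exact: measurableT.
- by move=> S _; rewrite adde_ge0// mule_ge0.
- by apply: emeasurable_funD => //; exact: measurable_funeM.
- exact: measurable_risk.
- by move=> S _; exact: ptw.
Qed.

(** At each point the error averaged over sign patterns is at least [1/10], half of the 1/5 of
    [err_flip]. The flipped coordinate depends on the point, so the average over patterns is taken
    inside the integral. Some pattern reaches the average, and the factor [2 * h] turns [1/10] into
    [h / 5]. *)
Lemma exists_excess_risk_ge :
  exists s, ((h / 5)%:E * mu B <= excess_risk f (PP s, QQ s))%E.
Proof.
have fsum x : #|{: {ffun J -> bool}}|%:R * (1 / 5 / 2) <= \sum_s err s x.
  exact: sum_flip_ge (cell x) _ (fun s => err_flip s x).
have err01 s x : 0 <= err s x <= 1.
  by rewrite -!lee_fin errE measure_ge0 probability_le1//; exact: measurable_wrong.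
apply/not_existsP => H.
have {}H s : (\int[mu]_(x in B) (err s x)%:E < (1 / 10)%:E * mu B)%E.
  rewrite ltNge; apply/negP => h1; apply: (H s).
  apply: le_trans (excess_risk_ge s); rewrite (_ : h / 5 = 2 * h * (1 / 10)).
    by rewrite EFinM -muleA; apply: lee_wpmul2l => //; rewrite lee_fin mulr_ge0.
  by field.
have : ((#|{: {ffun J -> bool}}|%:R * (1 / 10))%:E * mu B <=
    \sum_s \int[mu]_(x in B) (err s x)%:E)%E.
  rewrite -ge0_integral_sum//; last 2 first.
  - by move=> s; apply/measurable_EFinP; exact: measurable_funTS (measurable_err s).
  - by move=> s x _; rewrite lee_fin; case/andP: (err01 s x).
  rewrite -integral_cst//; apply: ge0_le_integral => //.
  - by move=> x _; rewrite lee_fin mulr_ge0.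
  - apply: emeasurable_sum => s.
    by apply/measurable_EFinP; exact: measurable_funTS (measurable_err s).
  - by move=> x _; rewrite sumEFin lee_fin; have := fsum x; lra.
have muBE : (fine (mu B))%:E = mu B by rewrite fineK// fin_num_measure.
have TE s : exists t : R, (\int[mu]_(x in B) (err s x)%:E = t%:E)%E /\
    t < 1 / 10 * fine (mu B).
  have h1 := H s; have T0 : (0 <= \int[mu]_(x in B) (err s x)%:E)%E.
    by apply: integral_ge0 => x _; rewrite lee_fin; case/andP: (err01 s x).
  have Tfin : (\int[mu]_(x in B) (err s x)%:E)%E \is a fin_num.
    by rewrite ge0_fin_numE//; apply: lt_trans h1 _; rewrite -muBE -EFinM ltry.
  exists (fine (\int[mu]_(x in B) (err s x)%:E)); split; first by rewrite fineK.
  by rewrite -lte_fin fineK// EFinM muBE.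
have [t tE] := boolp.choice TE.
rewrite (eq_bigr (fun s => (t s)%:E)); last by move=> s _; case: (tE s).
rewrite sumEFin -muBE -EFinM lee_fin leNgt => /negP; apply.
(* Strictness needs at least one sign pattern; the constant one serves. *)
have : \sum_s t s < \sum_(s : {ffun J -> bool}) 1 / 10 * fine (mu B).
  apply: ltr_sum => //; last by move=> s _; case: (tE s).
  by apply/hasP; exists [ffun => true] => //; rewrite mem_index_enum.
by rewrite sumr_const -[_ *+ _]mulr_natl [in X in X -> _]mulrA.
Qed.

End assouad.

Lemma minimax_risk_ge {R : realType} {d nP nQ : nat}
    (C : set (probability (obs R d) R * probability (obs R d) R)) (b : \bar R) :
  (forall f : classifier R d nP nQ, exists2 PQ, C PQ & (b <= excess_risk f PQ)%E) ->
  (b <= minimax_risk nP nQ C)%E.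
Proof.
move=> H; apply: le_ereal_inf_tmp => _ [f _ <-].
have [PQ CPQ /le_trans] := H f; apply.
by apply: ereal_sup_ubound; exists PQ.
Qed.

(** * Combs on the real line *)

Section comb.
Context {R : realType}.
Local Notation mu := (@lebesgue_measure R).

(** Being a preimage, this is [A] moved by [- c]. *)
Definition translate (c : R) (A : set R) : set R := (fun x => x + c) @^-1` A.

Lemma measurable_translate c (A : set R) :
  measurable A -> measurable (translate c A).
Proof.
move=> mA; rewrite -[X in measurable X]setTI.
have : measurable_fun [set: R] (fun x => x + c) by exact: measurable_funD.
exact.
Qed.

(** The pushforward of Lebesgue measure by a translation gives half-open intervals their length, and
    this determines the measure. *)
Lemma lebesgue_measure_translate (c : R) (A : set R) : measurable A ->
  mu (translate c A) = mu A.
Proof.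
move=> mA.
have mc : measurable_fun [set: measurableTypeR R]
    ((fun x => x + c) : measurableTypeR R -> measurableTypeR R).
  exact: measurable_funD.
pose phi : {mfun measurableTypeR R >-> measurableTypeR R} :=
  HB.pack (fun x : measurableTypeR R => x + c : measurableTypeR R)
    (isMeasurableFun.Build _ _ _ _ _ mc).
rewrite -[LHS]/(pushforward mu phi A).
apply/esym/lebesgue_measure_unique => //= _ [[a b]] _ <-.
rewrite /pushforward/=.
have -> : phi @^-1` `]a, b]%classic = `]a - c, b - c]%classic.
  by apply/seteqP; split => x /=; rewrite !in_itv/= => /andP[? ?]; lra.
rewrite !lebesgue_measure_itv/= !lte_fin ltrD2r.
by congr (if _ then _ else _); congr (_%:E); ring.
Qed.

Variable K : nat.
Hypothesis K0 : (0 < K)%N.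
Let r : R := K%:R^-1.

Let Kpos : 0 < K%:R :> R. Proof. by rewrite ltr0n. Qed.
Let r0 : 0 < r. Proof. by rewrite invr_gt0. Qed.
Let Kr : K%:R * r = 1. Proof. by rewrite mulfV// gt_eqF. Qed.

(** Teeth are closed so that the domain built from them is the whole support of its uniform law; the
    empty half of each period is the room in which signs may change. *)
Definition tooth (i : nat) : set R := `[i%:R * r, i%:R * r + r / 2]%classic.

Definition comb : set R := \bigcup_(i in `I_K) tooth i.

Lemma tooth_le1 i : (i < K)%N -> i%:R * r + r <= 1.
Proof.
move=> iK; rewrite -[leRHS]Kr -[X in _ + X]mul1r -mulrDl ler_pM2r//.
by rewrite natr1 ler_nat.
Qed.

Lemma measurable_comb : measurable comb.
Proof. by apply: fin_bigcup_measurable => // i _; exact: measurable_itv. Qed.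

Lemma closed_comb : closed comb.
Proof. by apply: closed_bigcup => // i _; exact: interval_closed. Qed.

Lemma comb01 u : comb u -> 0 <= u <= 1.
Proof.
move=> [i /= iK]; rewrite /tooth/= in_itv/= => /andP[u0 u1].
have := tooth_le1 _ iK.
have : 0 <= i%:R * r by rewrite mulr_ge0// ltW.
move: r0; lra.
Qed.

Lemma comb_cover u : 0 <= u <= 1 -> comb u \/ comb (u - r / 2).
Proof.
move=> /andP[u0 u1].
have [u1'|] := ltP u 1; last first.
  (* At [u = 1] truncation would give the index [K], which has no tooth; [1 - r / 2] is the right
     end of the last one. *)
  move=> h; have {u1 h} -> : u = 1 by lra.
  right; exists K.-1; first by rewrite /= prednK.
  rewrite /tooth/= in_itv/=.
  have -> : K.-1%:R * r = 1 - r.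
    rewrite -[X in _ = X - _]Kr -[X in _ = _ - X]mul1r -mulrBl; congr (_ * _).
    by rewrite -[in RHS](prednK K0) -natr1 addrK.
  move: r0; lra.
pose i := Num.truncn (u * K%:R).
have /andP[i1 i2] : i%:R <= u * K%:R < i.+1%:R.
  by apply: truncn_itv; rewrite mulr_ge0// ltW.
have iK : (i < K)%N.
  by rewrite -(ltr_nat R); apply: le_lt_trans i1 _; rewrite gtr_pMl.
have j1 : i%:R * r <= u by rewrite ler_pdivrMr.
have j2 : u < i%:R * r + r.
  by rewrite -[X in _ + X]mul1r -mulrDl natr1 ltr_pdivlMr.
have [h|h] := leP u (i%:R * r + r / 2); [left|right]; exists i => //;
  rewrite /tooth/= in_itv/=; lra.
Qed.

(** Consecutive teeth are exactly [r / 2] apart, and truncation after scaling by [K] returns the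
    index of a tooth. *)
Lemma comb_gap u v : comb u -> comb v -> `|u - v| < r / 2 ->
  Num.truncn (u * K%:R) = Num.truncn (v * K%:R).
Proof.
have T w i : tooth i w -> Num.truncn (w * K%:R) = i.
  rewrite /tooth/= in_itv/= => /andP[w1 w2]; apply: truncn_def.
  rewrite -ler_pdivrMr// w1/= -ltr_pdivlMr// -natr1 mulrDl mul1r.
  by apply: le_lt_trans w2 _; rewrite ltrD2l; move: r0; rewrite /r; lra.
move=> [i iK ui] [j jK vj]; rewrite (T _ _ ui) (T _ _ vj).
move: ui vj; rewrite /tooth/= !in_itv/= => /andP[u1 u2] /andP[v1 v2].
rewrite ltr_norml => /andP[uv1 uv2].
apply/eqP; rewrite eqn_leq; apply/andP; split; rewrite leqNgt; apply/negP => ij.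
  have : j%:R * r + r <= i%:R * r.
    by rewrite -[X in _ + X]mul1r -mulrDl ler_pM2r// natr1 ler_nat.
  lra.
have : i%:R * r + r <= j%:R * r.
  by rewrite -[X in _ + X]mul1r -mulrDl ler_pM2r// natr1 ler_nat.
lra.
Qed.

(* The comb and its translate by half a period cover [0, 1]. *)
Lemma comb_halving (A D : set R) (l : R) :
  measurable A -> measurable D -> A `<=` `[0, 1]%classic -> mu A = l%:E ->
  comb `&` A `<=` D -> comb `&` translate (r / 2) A `<=` D ->
  ((l / 2)%:E <= mu D)%E.
Proof.
move=> mA mD A01 muA AD tAD; have mC := measurable_comb.
pose tD := translate (- (r / 2)) D.
have mtD : measurable tD by exact: measurable_translate.
have muD : mu tD = mu D by exact: lebesgue_measure_translate.
have : (mu A <= mu (D `|` tD))%E.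
  apply: le_measure; rewrite ?inE//; first exact: measurableU.
  move=> x Ax; have := A01 _ Ax; rewrite /= in_itv/= => /comb_cover[Cx|Cx].
    by left; apply: AD.
  by right; apply: tAD; split => //; rewrite /translate/= subrK.
have U2 : (mu (D `|` tD) <= mu D + mu tD)%E by exact: measureU2.
move=> /le_trans /(_ U2); rewrite muA muD.
by case: (mu D) => [x| |] //=; rewrite -?EFinD ?lee_fin ?leey//; lra.
Qed.

Lemma comb_initial (s : R) : 0 <= s <= 1 ->
  ((s / 2)%:E <= mu (comb `&` `[0%R, s[%classic))%E.
Proof.
move=> /andP[s0 s1].
apply: (comb_halving `[0, s[%classic) => //.
- by apply: measurableI => //; exact: measurable_comb.
- by move=> x /=; rewrite !in_itv/= => /andP[? ?]; lra.
- rewrite lebesgue_measure_itv/= lte_fin; case: ltP => //; first by rewrite sube0.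
  by move=> h; congr (_%:E); lra.
- move=> x [Cx]; rewrite /translate/= => h; split => //; move: h => /=.
  rewrite !in_itv/= => /andP[h1 h2]; have := comb01 _ Cx; move: r0; lra.
Qed.

(** Two scales. A window shorter than a period meets the tooth of [u] itself in enough length. For a
    longer one, half of an interval of length [rho / 2] survives by [comb_halving], the shift
    [r / 2] being smaller than the remaining [rho / 2]. *)
Lemma comb_local (u rho : R) : comb u -> 0 < rho <= 1 ->
  ((rho / 4)%:E <= mu (comb `&` `[(u - rho)%R, (u + rho)%R]%classic))%E.
Proof.
move=> Cu /andP[rho0 rho1]; have mC := measurable_comb.
have mD : measurable (comb `&` `[(u - rho)%R, (u + rho)%R]%classic).
  exact: measurableI.
have muE (a b : R) : a <= b -> mu `[a, b]%classic = (b - a)%:E.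
  rewrite le_eqVlt lebesgue_measure_itv/= lte_fin => /predU1P[->|->//].
  by rewrite ltxx subrr.
have [rr|rr] := leP rho r.
  have [i iK] := Cu; rewrite /tooth/= in_itv/= => /andP[u1 u2].
  (* An interval of length [rho / 4 <= r / 4] fits into the tooth on the side of [u] where at least
     half of the tooth remains. *)
  pose a := if u <= i%:R * r + r / 4 then u else u - rho / 4.
  have aE : u - rho / 4 <= a <= u /\ i%:R * r <= a /\ a + rho / 4 <= i%:R * r + r / 2.
    rewrite /a; have [h|h] := leP u (i%:R * r + r / 4);
      by (split; [|split]); lra.
  have : (mu `[a, (a + rho / 4)%R]%classic <=
          mu (comb `&` `[(u - rho)%R, (u + rho)%R]%classic))%E.
    apply: le_measure; rewrite ?inE//.
    move=> x; rewrite /= in_itv/= => /andP[x1 x2]; split.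
      by exists i => //; rewrite /tooth/= in_itv/=; lra.
    by rewrite /= in_itv/=; lra.
  by rewrite muE; [rewrite (_ : a + _ - _ = rho / 4)//; lra|lra].
have u01 := comb01 _ Cu.
pose a := if u <= 1 / 2 then u else u - rho / 2.
have aE : u - rho / 2 <= a <= u /\ 0 <= a /\ a + rho / 2 <= 1.
  by rewrite /a; have [h|h] := leP u (1 / 2); (split; [|split]); lra.
rewrite (_ : rho / 4 = rho / 2 / 2); last by field.
apply: (comb_halving `[a, a + rho / 2]%classic) => //.
- by move=> x /=; rewrite !in_itv/= => /andP[? ?]; lra.
- by rewrite muE; [congr (_%:E); lra|lra].
- move=> x [Cx]; rewrite /= in_itv/= => /andP[? ?]; split => //.
  by rewrite /= in_itv/=; lra.
- move=> x [Cx]; rewrite /translate/= in_itv/= => /andP[? ?]; split => //.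
  by rewrite /= in_itv/=; move: r0; lra.
Qed.

End comb.
Arguments comb01 {R K} K0 [u].
Arguments comb_initial {R K} K0 s.
Arguments comb_local {R K} K0 [u rho].
Arguments comb_gap {R K} K0 [u v].

(** * Boxes and distances *)

Section uniform_law.
Context {d : measure_display} {T : measurableType d} {R : realType}.
Variables (lam : {measure set T -> \bar R}) (D : set T) (mD : measurable D).

(** The Dirac mass is the value of [mnormalize] when [D] has mass zero or infinity; [uniform_lawE]
    applies when the mass is positive and finite. *)
Definition uniform_law : probability T R :=
  mnormalize (mrestr lam mD) (\d_(point : T)).

Lemma uniform_lawE (l : R) : lam D = l%:E -> 0 < l ->
  forall A, uniform_law A = (lam (A `&` D) * (l^-1)%:E)%E.
Proof.
move=> lE l0 A; rewrite -(setTI D) in lE.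
change ((if (lam (setT `&` D) == 0%E) || (lam (setT `&` D) == +oo%E)
  then fun U => dirac (point : T) U
  else fun U => (lam (U `&` D) * ((fine (lam (setT `&` D)))^-1)%:E)%E) A =
  (lam (A `&` D) * (l^-1)%:E)%E).
by rewrite lE /= gt_eqF ?lte_fin.
Qed.

End uniform_law.

Section box.
Context {R : realType} {d : nat}.
Local Notation pt := (@Defs.point R d).

Definition box (A : 'I_d -> set R) : set pt := [set x | forall i, A i (tnth x i)].

Lemma measurable_box A : (forall i, measurable (A i)) -> measurable (box A).
Proof.
move=> mA; rewrite [X in measurable X](_ : _ =
    \bigcap_(i in [set: 'I_d]) ((@tnth d (measurableTypeR R) ^~ i) @^-1` A i)).
  apply: fin_bigcap_measurable => // i _.
  rewrite -[X in measurable X]setTI.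
  exact: (@measurable_tnth _ (measurableTypeR R) d i measurableT _ (mA i)).
by apply/seteqP; split => [x xA i _|x xA i]; [exact: xA|exact: (xA i)].
Qed.

Let prodE (l : R) : (\prod_(i < d) l%:E)%E = (l ^+ d)%:E.
Proof. by rewrite prodEFin prodr_const card_ord. Qed.

Let le_prode (F G : 'I_d -> \bar R) : (forall i, 0 <= F i)%E ->
  (forall i, F i <= G i)%E -> (\prod_(i < d) F i <= \prod_(i < d) G i)%E.
Proof.
move=> F0 FG.
pose P (x y : \bar R) := (0 <= x)%E /\ (x <= y)%E.
suff [] : P (\prod_(i < d) F i)%E (\prod_(i < d) G i)%E by [].
apply: big_ind2 => //.
- by move=> x1 y1 x2 y2 [? ?] [? ?]; split; [exact: mule_ge0|exact: lee_pmul].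
Qed.

Lemma lambda_box A : (forall i, measurable (A i)) ->
  lambda (box A) = (\prod_(i < d) lebesgue_measure (A i))%E.
Proof. by move=> mA; exact: tuple_measure_box. Qed.

Lemma lambda_box_ge A (l : R) : 0 <= l -> (forall i, measurable (A i)) ->
  (forall i, l%:E <= lebesgue_measure (A i))%E -> ((l ^+ d)%:E <= lambda (box A))%E.
Proof.
move=> l0 mA lA; rewrite lambda_box// -prodE.
by apply: le_prode => // i; rewrite lee_fin.
Qed.

Lemma lambda_box_le A (l : R) : (forall i, measurable (A i)) ->
  (forall i, lebesgue_measure (A i) <= l%:E)%E -> (lambda (box A) <= (l ^+ d)%:E)%E.
Proof. by move=> mA lA; rewrite lambda_box// -prodE; exact: le_prode. Qed.

Lemma le_lambda (A C : set pt) : measurable A -> measurable C -> A `<=` C ->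
  (lambda A <= lambda C)%E.
Proof. by move=> mA mC AC; apply: le_measure; rewrite ?inE. Qed.

End box.

Section edist.
Context {R : realType} {d : nat}.
Local Notation pt := (@Defs.point R d).
Local Notation edist := (@Defs.edist R d).
Implicit Types x y : pt.

Lemma edist_ge0 x y : 0 <= edist x y.
Proof. exact: sqrtr_ge0. Qed.

Lemma edistC x y : edist x y = edist y x.
Proof.
by rewrite /Defs.edist; congr Num.sqrt; apply: eq_bigr => i _; rewrite -sqrrN opprB.
Qed.

Lemma coord_le_edist x y i : `|tnth x i - tnth y i| <= edist x y.
Proof.
rewrite -sqrtr_sqr; apply: ler_wsqrtr.
by rewrite (bigD1 i)//= lerDl sumr_ge0// => j _; exact: sqr_ge0.
Qed.

Lemma edist_le x y (rho : R) : 0 <= rho ->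
  (forall i, `|tnth x i - tnth y i| <= rho) -> edist x y <= d%:R * rho.
Proof.
move=> rho0 H; rewrite -[leRHS]ger0_norm ?mulr_ge0// -sqrtr_sqr.
apply: ler_wsqrtr; apply: (@le_trans _ _ (\sum_(i < d) rho ^+ 2)).
  apply: ler_sum => i _.
  by rewrite -real_normK ?num_real// ler_sqr ?nnegrE.
rewrite sumr_const card_ord -[leLHS]mulr_natl exprMn.
apply: ler_wpM2r; first exact: sqr_ge0.
by rewrite -natrX ler_nat; case: (d) => // n; rewrite leq_pmull.
Qed.

Lemma measurable_eball x (rho : R) : measurable (eball x rho).
Proof.
have m : measurable_fun setT (edist x).
  have ms : measurable_fun [set: R] (@Num.sqrt R).
    exact (continuous_measurable_fun (@sqrt_continuous R)).
  apply: (measurableT_comp ms); apply: measurable_sum => i.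
  apply: measurable_funX; apply: measurable_funB => //.
  exact: measurable_tnth.
rewrite (_ : eball x rho = setT `&` (edist x : pt -> R) @^-1` `]-oo, rho[%classic).
  by apply: m => //.
by apply/seteqP; split => y; rewrite /eball/= in_itv/=; tauto.
Qed.

(** Without absolute values this is the supremum norm only where coordinates are nonnegative, as on
    the unit cube, which contains the domain. *)
Definition supnorm x : R := \big[Num.max/0]_(i < d) tnth x i.

Lemma supnorm_lt x (s : R) : 0 < s -> (supnorm x < s) <-> (forall i, tnth x i < s).
Proof.
move=> s0; split => [+ i|H].
  by apply: le_lt_trans; rewrite /supnorm (bigD1 i)//= le_max lexx.
by rewrite /supnorm; elim/big_ind: _ => // u v us vs; rewrite gt_max us.
Qed.

Lemma supnorm_ge0 x : 0 <= supnorm x.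
Proof.
rewrite /supnorm; elim: (index_enum _) => [|i s IH]; first by rewrite big_nil.
by rewrite big_cons le_max IH orbT.
Qed.

Lemma supnorm_lipschitz x y : supnorm x - supnorm y <= edist x y.
Proof.
rewrite lerBlDr [leLHS]/supnorm; elim/big_ind: _ => //.
- by rewrite addr_ge0// ?edist_ge0 ?supnorm_ge0.
- by move=> u v hu hv; rewrite ge_max hu.
- move=> i _; have h : tnth y i <= supnorm y.
    by rewrite /supnorm (bigD1 i)//= le_max lexx.
  have := coord_le_edist x y i; rewrite ler_norml => /andP[_]; lra.
Qed.

Lemma measurable_supnorm : measurable_fun setT supnorm.
Proof.
rewrite /supnorm; elim: (index_enum _) => [|i s IH].
  by under eq_fun do rewrite big_nil; exact: measurable_cst.
under eq_fun do rewrite big_cons.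
by apply: measurable_maxr => //; exact: measurable_tnth.
Qed.

End edist.

(** * The design domain *)

(** The set is a countable union of level sets of truncation. Level 0 is apart, since it also
    contains all negative reals. *)
Lemma measurable_truncn {R : realType} (Y : set nat) :
  measurable [set x : R | Y (Num.truncn x)].
Proof.
have mle n : measurable [set x : R | (Num.truncn x <= n)%N].
  rewrite (_ : [set x | _] = `]-oo, n.+1%:R[%classic); first exact: measurable_itv.
  by apply/seteqP; split => x /=; rewrite in_itv/= truncn_le_nat.
have meq n : measurable [set x : R | Num.truncn x = n].
  case: n => [|n].
    rewrite (_ : [set x | _] = [set x : R | (Num.truncn x <= 0)%N])//.
    by apply/seteqP; split => x /=; rewrite leqn0 => /eqP.
  rewrite (_ : [set x | _] = [set x : R | (Num.truncn x <= n.+1)%N] `\`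
                             [set x : R | (Num.truncn x <= n)%N]).
    exact: measurableD.
  apply/seteqP; split => x /=; first by move=> ->; rewrite leqnn ltnn.
  by case=> h1 /negP; rewrite -ltnNge => h2; apply/eqP; rewrite eqn_leq h1 h2.
rewrite (_ : [set x | _] = \bigcup_(n in Y) [set x : R | Num.truncn x = n]).
  exact: bigcup_measurable.
apply/seteqP; split => x /=; first by move=> Yx; exists (Num.truncn x).
by move=> [n Yn ->].
Qed.

Section comb_domain.
Context {R : realType} {d : nat}.
Local Notation pt := (@Defs.point R d).
Local Notation edist := (@Defs.edist R d).
Local Notation mu := (@lebesgue_measure R).
Hypothesis d0 : (0 < d)%N.
Variable K : nat.
Hypothesis K0 : (0 < K)%N.
Let r : R := K%:R^-1.
Let Kpos : 0 < K%:R :> R. Proof. by rewrite ltr0n. Qed.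
Let r0 : 0 < r. Proof. by rewrite invr_gt0. Qed.
Let Kr : K%:R * r = 1. Proof. by rewrite mulfV// gt_eqF. Qed.
Let dpos : 0 < d%:R :> R. Proof. by rewrite ltr0n. Qed.

Definition comb_domain : set pt := box (fun _ => comb K).

Lemma measurable_comb_domain : measurable comb_domain.
Proof. by apply: measurable_box => _; exact: measurable_comb. Qed.

Lemma comb_domain_cube : comb_domain `<=` @unit_cube R d.
Proof. by move=> x Cx i; apply: (comb01 K0); exact: Cx. Qed.

Lemma lambda_comb_domain :
  exists2 l : R, lambda comb_domain = l%:E & (1 / 2) ^+ d <= l <= 1.
Proof.
have mC := @measurable_comb R K.
have h1 : (((1 / 2) ^+ d)%:E <= lambda comb_domain)%E.
  apply: lambda_box_ge => // _.
  apply: le_trans (comb_initial K0 1 _) _; first by lra.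
  by apply: le_measure; rewrite ?inE//; exact: measurableI.
have h2 : (lambda comb_domain <= 1%:E)%E.
  rewrite -(expr1n R d); apply: lambda_box_le => // _.
  apply: (@le_trans _ _ (mu `[0, 1]%classic)).
    apply: le_measure; rewrite ?inE// => u /(comb01 K0) h.
    by rewrite /= in_itv/= h.
  by rewrite lebesgue_measure_itv/= lte_fin ltr01 sube0.
move: h1 h2; case: (lambda comb_domain) => [l| |]//=; rewrite ?lee_fin.
  by move=> h1 h2; exists l; rewrite ?h1.
Qed.

Lemma comb_domain_local (x : pt) (rho : R) : comb_domain x -> 0 < rho <= 1 ->
  (((rho / 4) ^+ d)%:E <= lambda (comb_domain `&`
    box (fun i => `[(tnth x i - rho)%R, (tnth x i + rho)%R]%classic)))%E.
Proof.
move=> Cx rho01.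
rewrite (_ : _ `&` _ = box (fun i => comb K `&`
    `[(tnth x i - rho)%R, (tnth x i + rho)%R]%classic)).
  apply: lambda_box_ge => [|i|i]; first lra.
    by apply: measurableI => //; exact: measurable_comb.
  by apply: (comb_local K0) => //; exact: Cx.
apply/seteqP; split => y; first by case=> h1 h2 i; split; [exact: h1|exact: h2].
by move=> h; split => i; case: (h i).
Qed.

Lemma comb_domain_ball (x : pt) (rho rho' : R) : comb_domain x ->
  0 < rho' <= 1 -> d%:R * rho' < rho ->
  (((rho' / 4) ^+ d)%:E <= lambda (comb_domain `&` eball x rho))%E.
Proof.
move=> Cx rho01 drho; have mD := measurable_comb_domain.
apply: le_trans (comb_domain_local _ _ Cx rho01) _.
apply: le_lambda.
- by apply: measurableI => //; apply: measurable_box => i.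
- by apply: measurableI => //; exact: measurable_eball.
move=> y [Cy By]; split => //; rewrite /eball/=.
apply: le_lt_trans drho; apply: edist_le; first lra.
by move=> i; have := By i; rewrite /= in_itv/= ler_norml => /andP[? ?]; lra.
Qed.

Lemma lambda_eball_le (x : pt) (rho : R) : 0 <= rho ->
  (lambda (eball x rho) <= ((2 * rho) ^+ d)%:E)%E.
Proof.
move=> rho0.
pose A i := `[(tnth x i - rho)%R, (tnth x i + rho)%R]%classic.
apply: (@le_trans _ _ (lambda (box A))).
  apply: le_lambda; first exact: measurable_eball.
    by apply: measurable_box => i; exact: measurable_itv.
  move=> y; rewrite /eball/= => xy i; rewrite /A/= in_itv/=.
  have := coord_le_edist x y i; rewrite ler_norml => /andP[? ?].
  by apply/andP; split; lra.
apply: lambda_box_le => i; first exact: measurable_itv.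
rewrite lebesgue_measure_itv/= lte_fin; case: ltP => _.
  by rewrite lee_fin; lra.
by rewrite lee_fin mulr_ge0.
Qed.

(** With [z] the minimum, the cube of half-side [z * rho] around [x] fits in the ball because
    [z <= 1 / (2 d)], and has half-side at most 1 because [z <= 1 / rl]. It contributes
    [(z * rho / 4) ^+ d], the ball has volume at most [(2 * rho) ^+ d], and the quotient is the
    threshold [(z / 8) ^+ d]. *)
Lemma comb_domain_strong_density (c rl : R) (x : pt) (rho : R) :
  0 < rl -> c <= (Num.min rl^-1 (2 * d%:R)^-1 / 8) ^+ d ->
  0 < rho < rl -> comb_domain x ->
  (c%:E * lambda (eball x rho) <= lambda (comb_domain `&` eball x rho))%E.
Proof.
move=> rl0 cle /andP[rho0 rhol] Cx.
set z := Num.min _ _ in cle.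
have rli : rl * rl^-1 = 1 by rewrite mulfV// gt_eqF.
have zp : 0 < z by rewrite lt_min !invr_gt0 rl0/= mulr_gt0.
have z1 : z * rl <= 1.
  by rewrite -rli mulrC ler_pM2l// ge_min lexx.
have z2 : z * (2 * d%:R) <= 1.
  by rewrite -ler_pdivlMr ?mulr_gt0// div1r ge_min lexx orbT.
have h1 : (((z * rho / 4) ^+ d)%:E <= lambda (comb_domain `&` eball x rho))%E.
  apply: comb_domain_ball => //.
    rewrite mulr_gt0//=; apply: le_trans z1; rewrite ler_pM2l//; exact: ltW.
  have : z * (2 * d%:R) * rho <= rho by rewrite ler_piMl// ltW.
  have : 0 < rho by []. lra.
apply: le_trans h1.
apply: (@le_trans _ _ (((z / 8) ^+ d)%:E * ((2 * rho) ^+ d)%:E)%E).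
  apply: (@le_trans _ _ (((z / 8) ^+ d)%:E * lambda (eball x rho))%E).
    by apply: lee_wpmul2r; rewrite ?lee_fin//; exact: measure_ge0.
  apply: lee_wpmul2l; last by apply: lambda_eball_le; exact: ltW.
  by rewrite lee_fin exprn_ge0// divr_ge0// ltW.
rewrite -EFinM lee_fin -exprMn (_ : z / 8 * (2 * rho) = z * rho / 4)//.
by field.
Qed.

Lemma comb_domain_separated (x : pt) : ~ comb_domain x ->
  exists2 e : R, 0 < e & comb_domain `&` eball x e = set0.
Proof.
move=> /existsNP[i Ci].
have oC : open (~` comb K : set R) by rewrite openC; exact: closed_comb.
have /nbhs_ballP[e /= e0 he] : nbhs (tnth x i : R) (~` comb K).
  exact: open_nbhs_nbhs.
exists e => //; apply/seteqP; split => // y [Cy]; rewrite /eball/= => xy.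
apply: (he (tnth y i) _ (Cy i)); rewrite /ball/=.
by apply: le_lt_trans xy; exact: coord_le_edist.
Qed.

(** [inord] makes the index total: values beyond [K], possible only outside the unit cube, are sent
    to 0. *)
Definition cell (x : pt) : {ffun 'I_d -> 'I_K.+1} :=
  [ffun i => inord (Num.truncn (tnth x i * K%:R))].

Lemma measurable_cell j : measurable [set x | cell x = j].
Proof.
rewrite (_ : [set x | _] =
    box (fun i => [set u : R | inord (Num.truncn (u * K%:R)) = j i])).
  apply: measurable_box => i.
  have := @measurable_truncn R [set n | inord n = j i].
  have mm : measurable_fun [set: R] (fun u : R => u * K%:R).
    exact: measurable_funM.
  by move/(mm measurableT); rewrite setTI.
apply/seteqP; split => x /=.
  by move=> <- i; rewrite /= ffunE.
by move=> h; apply/ffunP => i; rewrite ffunE; exact: h.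
Qed.

Lemma lambda_cell_le j :
  (lambda (comb_domain `&` [set x | cell x = j]) <= (r ^+ d)%:E)%E.
Proof.
pose A (i : 'I_d) := `[(j i)%:R * r, (j i)%:R * r + r]%classic.
apply: (@le_trans _ _ (lambda (box A))).
  apply: le_lambda.
  - apply: measurableI; [exact: measurable_comb_domain|exact: measurable_cell].
  - by apply: measurable_box => i; exact: measurable_itv.
  move=> x [Cx /= cx] i; have u01 : 0 <= tnth x i <= 1.
    by apply: (comb01 K0); exact: Cx.
  have /andP[t1 t2] := truncn_itv (mulr_ge0 (proj1 (andP u01)) (ltW Kpos)).
  have tK : (Num.truncn (tnth x i * K%:R) < K.+1)%N.
    rewrite -(ltr_nat R); apply: le_lt_trans t1 _; rewrite -natr1.
    have : tnth x i * K%:R <= K%:R by rewrite ler_piMl//; case/andP: u01.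
    lra.
  rewrite /A/= -cx ffunE inordK// in_itv/=; apply/andP; split.
    by rewrite ler_pdivrMr.
  rewrite -[X in _ + X]mul1r -mulrDl natr1 ler_pdivlMr//; exact: ltW.
apply: lambda_box_le => i; first exact: measurable_itv.
rewrite lebesgue_measure_itv/= lte_fin; case: ltP => _.
  by rewrite lee_fin; lra.
by rewrite lee_fin ltW.
Qed.

Lemma lambda_corner_ge (s : R) : 0 < s <= 1 ->
  (((s / 2) ^+ d)%:E <= lambda (comb_domain `&` [set x | (supnorm x < s)%R]))%E.
Proof.
move=> s01; rewrite (_ : _ `&` _ = box (fun i => comb K `&` `[0%R, s[%classic)).
  apply: lambda_box_ge => [|i|i]; first lra.
    by apply: measurableI => //; exact: measurable_comb.
  by apply: (comb_initial K0); lra.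
apply/seteqP; split => x /=.
  move=> [Cx /supnorm_lt xs] i; split; first exact: Cx.
  have := comb01 K0 (Cx i); rewrite /= in_itv/= => /andP[-> _].
  by apply: xs; lra.
move=> h; split; first by move=> i; case: (h i).
by apply/supnorm_lt => [|i]; [lra|case: (h i); rewrite /= in_itv/= => _ /andP[]].
Qed.

Lemma lambda_level_le (t : R) : 0 <= t ->
  (lambda (comb_domain `&` [set x | (supnorm x < t)%R]) <= (t ^+ d)%:E)%E.
Proof.
move=> t0; apply: (@le_trans _ _ (lambda (@box R d (fun _ => `[0%R, t]%classic)))).
  apply: le_lambda.
  - apply: measurableI; first exact: measurable_comb_domain.
    rewrite -[X in measurable X]setTI.
    rewrite (_ : [set x | _] = (@supnorm R d) @^-1` `]-oo, t[%classic).
      exact: measurable_supnorm.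
    by apply/seteqP; split => x; rewrite /= in_itv/=.
  - by apply: measurable_box => i; exact: measurable_itv.
  move=> x [Cx /= xt] i; have := comb01 K0 (Cx i).
  rewrite /= in_itv/= => /andP[-> _]/=; apply: le_trans (ltW xt).
  by rewrite /supnorm (bigD1 i)//= le_max lexx.
apply: lambda_box_le => i; first exact: measurable_itv.
rewrite lebesgue_measure_itv/= lte_fin; case: ltP => _.
  by rewrite lee_fin; lra.
by rewrite lee_fin.
Qed.

Lemma comb_domain_gap (x y : pt) : comb_domain x -> comb_domain y ->
  edist x y < r / 2 ->
  forall i, Num.truncn (tnth x i * K%:R) = Num.truncn (tnth y i * K%:R).
Proof.
move=> Cx Cy xy i; apply: (comb_gap K0); [exact: Cx|exact: Cy|].
by apply: le_lt_trans xy; exact: coord_le_edist.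
Qed.

(** The side of the corner is a whole number of periods, so belonging to the corner depends on the
    cell alone and never changes within a cell. *)
Lemma supnorm_lt_truncn (x : pt) (k : nat) : comb_domain x -> (0 < k)%N ->
  supnorm x < k%:R * r <-> forall i, (Num.truncn (tnth x i * K%:R) < k)%N.
Proof.
move=> Cx k0; rewrite supnorm_lt ?mulr_gt0 ?ltr0n//.
split=> H i; have := H i; have /andP[u0 _] := comb01 K0 (Cx i);
  rewrite truncn_lt_nat ?mulr_ge0// ?(ltW Kpos)// ltr_pdivlMr//.
Qed.

End comb_domain.
Arguments comb_domain_gap {R d K} K0 [x y].
Arguments supnorm_lt_truncn {R d K} K0 [x k].
Arguments comb_domain_strong_density {R d} d0 {K} K0 [c rl x rho].
Arguments comb_domain_separated {R d K} [x].
Arguments lambda_comb_domain {R d K} K0.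
Arguments lambda_cell_le {R d K} K0 j.
Arguments lambda_corner_ge {R d K} K0 [s].
Arguments lambda_level_le {R d K} K0 [t].
Arguments comb_domain_cube {R d K} K0.

(** * The regression functions *)

(** With [q = v / u <= 1] the difference is [u^b * (1 - q^b)]. Here [u^b <= u^beta], and [1 - q^b <=
    1 - q^n <= n * (1 - q) <= n * (1 - q)^beta]. The integer [n >= b] treats exponents below and
    above 1 alike. *)
Lemma powR_hoelder {R : realType} (u v b beta : R) (n : nat) :
  0 <= u <= 1 -> 0 <= v <= 1 -> 0 < b -> 0 <= beta <= 1 -> beta <= b ->
  (0 < n)%N -> b <= n%:R ->
  `|u `^ b - v `^ b| <= n%:R * `|u - v| `^ beta.
Proof.
wlog vu : u v / v <= u.
  move=> H hu hv; have [vu|/ltW uv] := leP v u; first exact: H.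
  by rewrite distrC (distrC u); exact: H.
move=> /andP[u0 u1] /andP[v0 v1] b0 /andP[t0 t1] tb n0 bn.
have n1 : 1 <= n%:R :> R by rewrite ler1n.
move: u0; rewrite le_eqVlt => /predU1P[ue|u0].
  have ve : v = 0 by apply/eqP; rewrite eq_le v0 ue vu.
  by rewrite -ue ve !subrr normr0 mulr_ge0// powR_ge0.
set q := v / u; have q0 : 0 <= q by rewrite divr_ge0// ltW.
have q1 : q <= 1 by rewrite ler_pdivrMr// mul1r.
have vE : v = u * q by rewrite /q mulrCA divff ?mulr1// gt_eqF.
have vb : v `^ b = u `^ b * q `^ b by rewrite vE powRM// ltW.
rewrite !ger0_norm; last 2 first.
- by rewrite subr_ge0.
- by rewrite subr_ge0 ge0_ler_powR ?nnegrE ?(ltW b0) ?(ltW u0).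
have -> : u - v = u * (1 - q) by rewrite vE; ring.
rewrite vb powRM ?subr_ge0 ?(ltW u0)//.
have h1 : u `^ b <= u `^ beta by apply: ger_powR => //; rewrite u0.
have h2 : 1 - q `^ b <= n%:R * (1 - q).
  have : q ^+ n <= q `^ b.
    move: q0; rewrite le_eqVlt => /predU1P[<-|q0].
      by rewrite expr0n gtn_eqF// powR_ge0.
    by rewrite -powR_mulrn ?(ltW q0)//; apply: ger_powR => //; rewrite q0.
  have : 1 - q ^+ n <= n%:R * (1 - q).
    elim: (n) => [|m IH]; first by rewrite expr0 subrr mul0r.
    have : q ^+ m <= 1 by exact: exprn_ile1.
    rewrite exprS -natr1.
    have : q ^+ m * (1 - q) <= 1 * (1 - q) by apply: ler_wpM2r; [lra|exact: exprn_ile1].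
    lra.
  lra.
have h3 : 1 - q <= (1 - q) `^ beta.
  move: q1; rewrite le_eqVlt => /predU1P[->|q1].
    by rewrite subrr powR_ge0.
  by apply: ger1_powR => //; apply/andP; split; lra.
have -> : u `^ b - u `^ b * q `^ b = u `^ b * (1 - q `^ b) by ring.
rewrite mulrCA; apply: ler_pM => //.
- exact: powR_ge0.
- rewrite subr_ge0; apply: (@le_trans _ _ (1 `^ b)); last by rewrite powR1.
  by rewrite ge0_ler_powR ?nnegrE// (ltW b0).
by apply: (le_trans h2); rewrite ler_wpM2l.
Qed.

Section bump.
Context {R : realType} {d : nat}.
Variables (K k : nat).
Local Notation pt := (@Defs.point R d).
Local Notation edist := (@Defs.edist R d).
Local Notation J := {ffun 'I_d -> 'I_K.+1}.
Local Notation r := (K%:R^-1 : R).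
Local Notation s := (k%:R * K%:R^-1 : R).
Implicit Types (sig : {ffun J -> bool}).

Definition best sig (x : pt) : bool :=
  if supnorm x < s then sig (cell K x) else true.

(** The cap at 1 makes powers of the width decrease in the exponent, which the Hoelder estimates
    use. *)
Definition width (x : pt) : R :=
  Num.min 1 (r + Num.max 0 (supnorm x - s)).

(** One formula for both populations: [(kappa, b)] gives the target regression function and
    [(kappa^gamma, gamma * b)] the source one, whose distance to 1/2 is then the [gamma]-th power of
    the target's. *)
Definition bump (kappa e : R) sig (x : pt) : R :=
  1 / 2 + (if best sig x then 1 else -1) * (kappa * width x `^ e).

Lemma measurable_supnorm_lt (t : R) : measurable [set x : pt | supnorm x < t].
Proof.
rewrite -[X in measurable X]setTI.
rewrite (_ : [set x | _] = (@supnorm R d) @^-1` `]-oo, t[%classic).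
  exact: measurable_supnorm.
by apply/seteqP; split => x; rewrite /= in_itv/=.
Qed.

Lemma measurable_best sig : measurable_fun setT (best sig).
Proof.
apply: measurable_fun_ifT => //.
  by apply: measurable_fun_ltr => //; exact: measurable_supnorm.
apply: (measurable_fun_bool true); rewrite setTI.
rewrite (_ : _ @^-1` _ = \bigcup_(j in [set j : J | sig j]) [set x | cell K x = j]).
  by apply: fin_bigcup_measurable => // j _; exact: measurable_cell.
apply/seteqP; split => x /=; first by move=> h; exists (cell K x).
by move=> [j /= sj ->].
Qed.

Lemma measurable_width : measurable_fun setT width.
Proof.
apply: measurable_minr => //; apply: measurable_funD => //.
apply: measurable_maxr => //; apply: measurable_funB => //.
exact: measurable_supnorm.
Qed.

Lemma measurable_bump kappa e sig : measurable_fun setT (bump kappa e sig).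
Proof.
apply: measurable_funD => //; apply: measurable_funM.
  by apply: measurable_fun_ifT => //; exact: measurable_best.
apply: measurable_funM => //.
apply: (measurableT_comp (@measurable_powR R e)).
exact: measurable_width.
Qed.

HB.instance Definition _ kappa e sig :=
  isMeasurableFun.Build _ _ _ _ (bump kappa e sig) (measurable_bump kappa e sig).

Hypothesis K0 : (0 < K)%N.
Hypothesis k0 : (0 < k)%N.

Let Kpos : 0 < K%:R :> R. Proof. by rewrite ltr0n. Qed.
Let r0 : 0 < r. Proof. by rewrite invr_gt0. Qed.
Let r1 : r <= 1. Proof. by rewrite invf_le1// ler1n. Qed.

Lemma width_ge x : r <= width x.
Proof. by rewrite /width le_min r1/= lerDl le_max lexx. Qed.

Lemma width01 x : 0 < width x <= 1.
Proof. by rewrite (lt_le_trans r0 (width_ge x)) /width ge_min lexx. Qed.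

Lemma width_corner x : supnorm x < s -> width x = r.
Proof.
move=> xs; rewrite /width (@max_l _ _ 0) ?subr_le0 ?(ltW xs)// addr0.
by rewrite min_r.
Qed.

Lemma width_lipschitz x y : `|width x - width y| <= edist x y.
Proof.
have e0 := edist_ge0 x y.
have h1 := supnorm_lipschitz x y; have := supnorm_lipschitz y x.
rewrite edistC => h2; rewrite ler_norml /width !minEle !maxEle.
by repeat case: ifPn; rewrite -?ltNge => *; apply/andP; split; lra.
Qed.

Lemma bump_abs (kappa e : R) sig (x : pt) : 0 <= kappa ->
  `|bump kappa e sig x - 1 / 2| = kappa * width x `^ e.
Proof.
move=> kap0; rewrite /bump addrC addKr normrM.
rewrite [X in _ * X]ger0_norm ?mulr_ge0 ?powR_ge0//.
by case: ifP => _; rewrite ?normrN normr1 mul1r.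
Qed.

Lemma bump_sign (kappa e : R) sig (x : pt) : 0 <= kappa ->
  0 <= (if best sig x then 1 else -1) * (bump kappa e sig x - 1 / 2).
Proof.
move=> kap0; rewrite /bump [X in _ * X]addrC addKr.
by case: ifP => _; rewrite ?mul1r ?mulN1r ?opprK mulr_ge0 ?powR_ge0.
Qed.

Lemma width_powR_le1 e x : 0 <= e -> width x `^ e <= 1.
Proof.
move=> e0; have /andP[w0 w1] := width01 x.
by rewrite -(powRr0 (width x)); apply: ger_powR => //; rewrite w0.
Qed.

Lemma bump01 (kappa e : R) sig (x : pt) : 0 <= kappa <= 1 / 2 -> 0 <= e ->
  0 <= bump kappa e sig x <= 1.
Proof.
move=> /andP[kap0 kap1] e0.
have : kappa * width x `^ e <= 1 / 2 * 1.
  by apply: ler_pM => //; rewrite ?powR_ge0 ?width_powR_le1.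
have : 0 <= kappa * width x `^ e by rewrite mulr_ge0 ?powR_ge0.
by rewrite /bump; case: ifP => _; lra.
Qed.

Lemma best_gap sig x y : comb_domain K x -> comb_domain K y ->
  edist x y < r / 2 -> best sig x = best sig y.
Proof.
move=> Cx Cy xy; have H := comb_domain_gap K0 Cx Cy xy.
rewrite /best; have -> : cell K x = cell K y.
  by apply/ffunP => i; rewrite !ffunE H.
congr (if _ then _ else _).
have Ex := supnorm_lt_truncn K0 Cx k0; have Ey := supnorm_lt_truncn K0 Cy k0.
by apply/idP/idP => [/Ex h|/Ey h]; [apply/Ey|apply/Ex] => i;
  have := h i; rewrite H.
Qed.

(** For equal signs only the widths differ, and [powR_hoelder] applies since [width] is 1-Lipschitz.
    For opposite signs there is no cancellation, but the points are at least [r / 2] apart, so each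
    deviation from 1/2 is itself of the order of the distance to the power [beta]. *)
Lemma bump_hoelder (kappa e beta C : R) (n : nat) sig (x y : pt) :
  comb_domain K x -> comb_domain K y ->
  0 <= kappa -> 0 < e -> 0 <= beta <= 1 -> beta <= e -> (0 < n)%N -> e <= n%:R ->
  6 * n%:R * kappa <= C ->
  `|bump kappa e sig x - bump kappa e sig y| <= C * edist x y `^ beta.
Proof.
move=> Cx Cy kap0 e0 beta01 betae n0 en kapC.
have /andP[b0 b1] := beta01.
have n1 : 1 <= n%:R :> R by rewrite ler1n.
have ed0 := edist_ge0 x y.
have P0 : 0 <= edist x y `^ beta by exact: powR_ge0.
have w01 z : 0 <= width z <= 1 by have := width01 z; lra.
have kap6 : 6 * kappa <= 6 * n%:R * kappa by rewrite ler_wpM2r// ler_peMr.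
have [bxy|bxy] := boolP (best sig x == best sig y).
  have -> : `|bump kappa e sig x - bump kappa e sig y| =
      kappa * `|width x `^ e - width y `^ e|.
    rewrite /bump (eqP bxy) -[in RHS](ger0_norm kap0) -normrM mulrBr.
    case: ifP => _; first by congr `|_|; ring.
    by rewrite distrC; congr `|_|; ring.
  have h1 := @powR_hoelder R _ _ e beta n (w01 x) (w01 y) e0 beta01 betae n0 en.
  have h2 : `|width x - width y| `^ beta <= edist x y `^ beta.
    by rewrite ge0_ler_powR ?nnegrE// width_lipschitz.
  apply: (@le_trans _ _ (kappa * (n%:R * edist x y `^ beta))).
    apply: ler_wpM2l => //; apply: (le_trans h1); apply: ler_wpM2l => //; lra.
  rewrite mulrA; apply: ler_wpM2r => //; apply: le_trans kapC.
  by rewrite mulrC ler_wpM2r// ler_peMl//; lra.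
have exy : r / 2 <= edist x y.
  by rewrite leNgt; apply: contra bxy => /(best_gap sig _ _ Cx Cy) ->.
have wl := width_lipschitz x y; rewrite ler_norml in wl.
(* Signs are positive outside the corner, so one of the points lies in it and has width
   [r <= 2 * edist x y]; the Lipschitz bound gives 3 for the other. The two bounds add up to the
   constant 6. *)
have w3 : width x <= 3 * edist x y /\ width y <= 3 * edist x y.
  have [xs|xs] := boolP (supnorm x < s).
    by have := width_corner _ xs; lra.
  have [ys|ys] := boolP (supnorm y < s).
    by have := width_corner _ ys; lra.
  by move: bxy; rewrite /best (negbTE xs) (negbTE ys) eqxx.
have wb z : width z <= 3 * edist x y -> width z `^ e <= 3 * edist x y `^ beta.
  move=> w3'; apply: (@le_trans _ _ (width z `^ beta)).
    by apply: ger_powR => //; exact: width01.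
  apply: (@le_trans _ _ ((3 * edist x y) `^ beta)).
    have /andP[? _] := w01 z.
    by rewrite ge0_ler_powR ?nnegrE//; lra.
  rewrite powRM//; apply: ler_wpM2r => //.
  by apply: ler1_powR => //; lra.
have [wx wy] := (wb _ w3.1, wb _ w3.2).
apply: (@le_trans _ _ (kappa * (width x `^ e + width y `^ e))).
  rewrite mulrDr -(bump_abs _ e sig x kap0) -(bump_abs _ e sig y kap0).
  rewrite (_ : bump kappa e sig x - _ =
    (bump kappa e sig x - 1 / 2) - (bump kappa e sig y - 1 / 2)); last by ring.
  exact: ler_normB.
apply: (@le_trans _ _ (kappa * (6 * edist x y `^ beta))).
  by apply: ler_wpM2l => //; lra.
by rewrite mulrA ler_wpM2r//; lra.
Qed.

Lemma bump_signal (kappa gam e : R) sig (x : pt) : 0 <= kappa -> 0 < gam ->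
  0 <= (bump (kappa `^ gam) (gam * e) sig x - 1 / 2) * (bump kappa e sig x - 1 / 2) /\
  `|bump (kappa `^ gam) (gam * e) sig x - 1 / 2| = `|bump kappa e sig x - 1 / 2| `^ gam.
Proof.
move=> kap0 gam0; split.
  have := bump_sign (kappa `^ gam) (gam * e) sig x (powR_ge0 _ _).
  have := bump_sign kappa e sig x kap0.
  case: ifP => _; rewrite ?mul1r ?mulN1r; first by move=> *; exact: mulr_ge0.
  by rewrite !oppr_ge0 => *; exact: mulr_le0.
rewrite !bump_abs ?powR_ge0// powRM// ?powR_ge0// -powRrM.
by rewrite (mulrC e).
Qed.

Lemma bump_flip kappa e sig j x : supnorm x < s -> cell K x = j ->
  bump kappa e (flip j sig) x = 1 - bump kappa e sig x.
Proof.
move=> xs xj; rewrite /bump /best xs xj flip_at.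
by case: (sig j) => /=; field.
Qed.

Lemma bump_flip_neq kappa e sig j x : ~ (supnorm x < s /\ cell K x = j) ->
  bump kappa e (flip j sig) x = bump kappa e sig x.
Proof.
move=> H; rewrite /bump (_ : best (flip j sig) x = best sig x)//.
rewrite /best; case: ifPn => // xs.
by rewrite flip_neq//; apply/eqP => xj; apply: H.
Qed.

End bump.

(** * The uniform design on the comb domain: mass, support and density *)

Section design.
Context {R : realType} {d : nat}.
Hypothesis d0 : (0 < d)%N.
Variable K : nat.
Hypothesis K0 : (0 < K)%N.
Local Notation pt := (@Defs.point R d).
Local Notation dom := (@comb_domain R d K).

Definition design : probability pt R :=
  uniform_law (tuple_measure (@lebesgue_measure R) d) dom
    (measurable_comb_domain K).

(** The mass [l] of the domain is known only up to a factor [2 ^+ d]; this is the source of that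
    factor in later constants. *)
Lemma designP : exists2 l : R, (1 / 2) ^+ d <= l <= 1 &
  forall A, design A = (lambda (A `&` dom) * (l^-1)%:E)%E.
Proof.
have [l lE l01] := @lambda_comb_domain R d K K0.
have lp : 0 < l.
  by case/andP: l01 => + _; apply: lt_le_trans; exact: exprn_gt0.
exists l => // A.
exact: (@uniform_lawE _ _ R (tuple_measure (@lebesgue_measure R) d) dom
  (measurable_comb_domain K) l lE lp A).
Qed.

Lemma design_ge A (a : R) : 0 <= a -> (a%:E <= lambda (A `&` dom))%E ->
  (a%:E <= design A)%E.
Proof.
move=> a0 aA; have [l /andP[l0 l1] ->] := designP.
have lp : 0 < l by apply: lt_le_trans l0; exact: exprn_gt0.
rewrite -[leLHS]mule1; apply: lee_pmul => //; rewrite ?lee_fin//.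
by rewrite invf_ge1.
Qed.

Lemma design_le A (a : R) : (lambda (A `&` dom) <= a%:E)%E ->
  (design A <= (2 ^+ d * a)%:E)%E.
Proof.
move=> Aa; have [l /andP[l0 l1] ->] := designP.
have lp : 0 < l by apply: lt_le_trans l0; exact: exprn_gt0.
rewrite mulrC EFinM; apply: lee_pmul => //; rewrite ?lee_fin//.
- by rewrite invr_ge0 ltW.
- rewrite -[leRHS]invrK lef_pV2 ?posrE ?invr_gt0 ?exprn_gt0//.
  by apply: le_trans l0; rewrite div1r exprVn.
Qed.

Lemma design_dom : design dom = 1%E.
Proof.
apply/eqP; rewrite eq_le probability_le1/=; last exact: measurable_comb_domain.
have [l lE l01] := @lambda_comb_domain R d K K0.
have lp : 0 < l.
  by case/andP: l01 => + _; apply: lt_le_trans; exact: exprn_gt0.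
rewrite (@uniform_lawE _ _ R (tuple_measure (@lebesgue_measure R) d) dom
  (measurable_comb_domain K) l lE lp) setIid [X in (X * _)%E]lE -EFinM divff//.
by rewrite gt_eqF.
Qed.

(** [mu] stands for the marginal of either labelled law, for which agreement with [design] is
    available on measurable sets. *)
Variable mu : set pt -> \bar R.
Hypothesis muE : forall A, measurable A -> mu A = design A.

Lemma support_design : Defs.support mu = dom.
Proof.
apply/seteqP; split => x.
  move=> sx; apply: contrapT => /comb_domain_separated[e e0 ex].
  have := sx e e0; rewrite muE; last exact: measurable_eball.
  have [l _ ->] := designP.
  have l0 : lambda (set0 : set pt) = 0%E.
    exact: (measure0 (tuple_measure (@lebesgue_measure R) d)).
  by rewrite setIC ex l0 mul0e ltxx.
move=> Cx rho rho0; rewrite muE; last exact: measurable_eball.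
pose t := Num.min 1 (rho / (2 * d%:R)).
have dp : 0 < d%:R :> R by rewrite ltr0n.
have t0 : 0 < t by rewrite lt_min ltr01 divr_gt0// mulr_gt0.
have t1 : t <= 1 by rewrite ge_min lexx.
have t2 : d%:R * t < rho.
  have : t * (2 * d%:R) <= rho.
    by rewrite -ler_pdivlMr ?mulr_gt0// ge_min lexx orbT.
  lra.
apply: (@lt_le_trans _ _ ((t / 4) ^+ d)%:E).
  by rewrite lte_fin exprn_gt0// divr_gt0.
apply: design_ge; first by rewrite exprn_ge0// divr_ge0// ltW.
rewrite setIC; apply: comb_domain_ball => //; by rewrite t0.
Qed.

Lemma design_density (theta : parameters R) : 0 < c_lambda theta ->
  c_lambda theta < (1 / 2) ^+ d -> density_bounded theta mu dom.
Proof.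
move=> c0 c1; have [l /andP[l0 l1] lE] := designP.
have lp : 0 < l by apply: lt_le_trans l0; exact: exprn_gt0.
have mD := @measurable_comb_domain R d K.
exists (fun x => l^-1 * \1_dom x).
  split.
  - by apply: measurable_funM => //; exact: measurable_indic.
  - by move=> x; rewrite mulr_ge0// invr_ge0 ltW.
  - move=> A mA; rewrite muE// lE.
    under eq_integral do rewrite EFinM.
    rewrite ge0_integralZl//; last 2 first.
    + by apply/measurable_EFinP; exact: measurable_indic.
    + by rewrite lee_fin invr_ge0 ltW.
    by rewrite integral_indic// muleC setIC.
move=> x Dx; rewrite indicE mem_set// mulr1.
have c2 : c_lambda theta < l by exact: lt_le_trans l0.
rewrite ltf_pV2 ?posrE// c2 andbT; apply: lt_le_trans c2 _.
by apply: (le_trans l1); rewrite invf_ge1.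
Qed.

End design.

(** * The hard family lies in the class *)

Lemma bernoulli_ineq {R : realDomainType} (x : R) (n : nat) :
  0 <= x <= 1 -> 1 - n%:R * x <= (1 - x) ^+ n.
Proof.
move=> /andP[x0 x1]; elim: n => [|n IH]; first by rewrite mul0r subr0 expr0.
rewrite exprS; apply: (@le_trans _ _ ((1 - x) * (1 - n%:R * x))).
  have : 0 <= n%:R * x * x by rewrite !mulr_ge0.
  rewrite -natr1; lra.
by rewrite ler_wpM2l// subr_ge0.
Qed.

Section hard_instance.
Context {R : realType} {d : nat}.
Hypothesis d0 : (0 < d)%N.
Local Notation pt := (@Defs.point R d).
Variable theta : parameters R.
Let al := alpha theta.
Let gam := gamma theta.
Let CB := C_beta theta.
Variables (b kappa : R) (n K k : nat).
Local Notation r := (K%:R^-1 : R).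
Local Notation s := (k%:R * K%:R^-1 : R).
Hypothesis K0 : (0 < K)%N.
Hypothesis k0 : (0 < k)%N.
Hypothesis adm : admissible theta.
Hypothesis b0 : 0 < b.
Hypothesis bQ : betaQ theta <= b.
Hypothesis bP : betaP theta <= gam * b.
Hypothesis n0 : (0 < n)%N.
Hypothesis bn : b <= n%:R.
Hypothesis gbn : gam * b <= n%:R.
Hypothesis kap0 : 0 < kappa.
Hypothesis kap1 : kappa <= 1 / 2.
Hypothesis kapg1 : kappa `^ gam <= 1 / 2.
Hypothesis kapC : 6 * n%:R * kappa <= CB.
Hypothesis kapgC : 6 * n%:R * kappa `^ gam <= CB.
Hypothesis clam : c_lambda theta <=
  (Num.min (r_lambda theta)^-1 (2 * d%:R)^-1 / 8) ^+ d.
Hypothesis calpha : 6 ^+ d * kappa `^ (- al) <= C_alpha theta.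
Hypothesis abd : al * b <= d%:R.
Hypothesis s2 : s <= 2 * r `^ (al * b / d%:R).

Local Notation J := {ffun 'I_d -> 'I_K.+1}.
Definition etaP (sig : {ffun J -> bool}) : {mfun pt >-> R} :=
  bump K k (kappa `^ gam) (gam * b) sig.
Definition etaQ (sig : {ffun J -> bool}) : {mfun pt >-> R} :=
  bump K k kappa b sig.

Let gam0 : 0 < gam. Proof. by case: adm => _ [[]]. Qed.
Let al0 : 0 <= al. Proof. by case: adm => -[]. Qed.
Let kapg0 : 0 < kappa `^ gam. Proof. exact: powR_gt0. Qed.
Let gb0 : 0 < gam * b. Proof. exact: mulr_gt0. Qed.
Let Kpos : 0 < K%:R :> R. Proof. by rewrite ltr0n. Qed.
Let r0 : 0 < r. Proof. by rewrite invr_gt0. Qed.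
Let r1 : r <= 1. Proof. by rewrite invf_le1// ler1n. Qed.
Let dpos : 0 < d%:R :> R. Proof. by rewrite ltr0n. Qed.

Lemma etaP01 sig x : 0 <= etaP sig x <= 1.
Proof. by apply: bump01 => //; [rewrite ltW//=|exact: ltW]. Qed.

Lemma etaQ01 sig x : 0 <= etaQ sig x <= 1.
Proof. by apply: bump01 => //; [rewrite ltW//=|exact: ltW]. Qed.

Let PP sig : probability (obs R d) R := label_law (design K) (etaP sig).
Let QQ sig : probability (obs R d) R := label_law (design K) (etaQ sig).

Lemma unit_cube_law (eta : {mfun pt >-> R}) : (forall x, 0 <= eta x <= 1) ->
  label_law (design K) eta (@unit_cube R d `*` setT) = 1%E.
Proof.
move=> eta01; have mU : measurable (@unit_cube R d).
  rewrite (_ : @unit_cube R d = box (fun _ => `[0, 1]%classic)).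
    by apply: measurable_box => i; exact: measurable_itv.
  by apply/seteqP; split => x h i; have := h i; rewrite /= in_itv.
rewrite setXT label_law_fst//.
apply/eqP; rewrite eq_le probability_le1//= -(@design_dom R d K K0).
apply: le_measure; rewrite ?inE//; first exact: measurable_comb_domain.
exact: comb_domain_cube.
Qed.

(** The event is [width < tau] with [tau = (t / kappa)^(1/b)]. It is empty if [tau <= r], and for
    [tau >= 1] the bound exceeds 1. In between it lies in the corner of side
    [tau + s - r <= 3 * tau^(al b / d)], whose mass is at most [2^d * 3^d * tau^(al b) = 6^d * (t /
    kappa)^al]; hence the threshold on [C_alpha]. *)
Lemma tsybakov_bump sig : tsybakov_noise theta (QQ sig) (etaQ sig).
Proof.
move=> t /andP[t0 t1].
have mE : measurable [set x : pt | `|etaQ sig x - 1 / 2| < t].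
  rewrite -[X in measurable X]setTI.
  rewrite (_ : [set x | _] = (fun x => `|etaQ sig x - 1 / 2|) @^-1` `]-oo, t[%classic).
    have : measurable_fun setT (fun x => `|etaQ sig x - 1 / 2|).
      apply: measurableT_comp => //; exact: measurable_funB.
    by move=> h; exact: h.
  by apply/seteqP; split => x; rewrite /= in_itv/=.
rewrite marginal_label_law//; last exact: etaQ01.
have aE x : `|etaQ sig x - 1 / 2| = kappa * width K k x `^ b.
  by apply: bump_abs; exact: ltW.
have [tk|tk] := leP t (kappa * r `^ b).
  rewrite (_ : [set x | _] = set0).
    by rewrite measure0 lee_fin mulr_ge0 ?powR_ge0//; case: adm => _ [[_ _ _ _ /ltW]].
  apply/seteqP; split => x //=; rewrite aE => h.
  have : kappa * r `^ b <= kappa * width K k x `^ b.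
    rewrite ler_pM2l// ge0_ler_powR ?nnegrE ?(ltW b0) ?(ltW r0)//.
      by have := width01 K k K0 x; lra.
    exact: width_ge.
  lra.
pose tau := (t / kappa) `^ b^-1.
have tk0 : 0 < t / kappa by rewrite divr_gt0.
have tau0 : 0 < tau by exact: powR_gt0.
have taub : tau `^ b = t / kappa.
  by rewrite /tau -powRrM mulVf ?gt_eqF// powRr1// ltW.
have rtau : r < tau.
  have : r `^ b < t / kappa by rewrite ltr_pdivlMr// mulrC.
  rewrite -taub => h; rewrite ltNge; apply/negP => tr.
  have : tau `^ b <= r `^ b.
    by rewrite ge0_ler_powR ?nnegrE ?(ltW b0) ?(ltW r0) ?(ltW tau0).
  lra.
have CA : 6 ^+ d * (t / kappa) `^ al <= C_alpha theta * t `^ al.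
  rewrite powRM ?(ltW t0) ?invr_ge0 ?(ltW kap0)//.
  rewrite -powR_inv1 ?(ltW kap0)// -powRrM mulN1r.
  rewrite mulrA mulrAC; apply: ler_wpM2r => //; exact: powR_ge0.
apply: (@le_trans _ _ (6 ^+ d * (t / kappa) `^ al)%:E); last by rewrite lee_fin.
have [tau1|tau1] := leP 1 tau.
  apply: (@le_trans _ _ 1%E); first exact: probability_le1.
  rewrite lee_fin; apply: mulr_ege1.
    by apply: exprn_ege1; lra.
  rewrite -(powRr0 (t / kappa)); apply: ler_powR => //.
  rewrite -taub -(powRr0 tau); apply: ler_powR => //; exact: ltW.
have q0 : 0 <= tau `^ (al * b / d%:R) by exact: powR_ge0.
have e1 : al * b / d%:R <= 1 by rewrite ler_pdivrMr// mul1r.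
have e0 : 0 <= al * b / d%:R by rewrite !mulr_ge0 ?invr_ge0// ltW.
(* The assumption [al * b <= d] enters here: for [tau < 1] the smaller exponent gives the larger
   power. *)
have tauq : tau <= tau `^ (al * b / d%:R).
  by apply: ger1_powR => //; rewrite tau0 ltW.
have rq : r `^ (al * b / d%:R) <= tau `^ (al * b / d%:R).
  by rewrite ge0_ler_powR// ?nnegrE// ltW.
have h : (lambda ([set x : pt | (`|etaQ sig x - 1 / 2| < t)%R] `&` comb_domain K) <=
    ((3 * tau `^ (al * b / d%:R)) ^+ d)%:E)%E.
  apply: le_trans (lambda_level_le K0 (mulr_ge0 _ q0)); last by lra.
  apply: le_lambda.
  - by apply: measurableI => //; exact: measurable_comb_domain.
  - apply: measurableI; [exact: measurable_comb_domain|exact: measurable_supnorm_lt].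
  move=> x [/= + Dx]; rewrite aE => h; split => //=.
  have wtau : width K k x < tau.
    rewrite ltNge; apply/negP => tw.
    have : tau `^ b <= width K k x `^ b.
      rewrite ge0_ler_powR ?nnegrE ?(ltW b0) ?(ltW tau0)//.
      by have := width01 K k K0 x; lra.
    rewrite taub ler_pdivrMr// mulrC; lra.
  have : r + (supnorm x - s) <= width K k x \/ 1 <= width K k x.
    rewrite /width minEle; case: ifP => _; [by right|left].
    by rewrite lerD2l le_max lexx orbT.
  case=> h2; last lra.
  have : supnorm x < tau + s - r by lra.
  move: s2 rq tauq r0; set S := s; set p := r `^ _; set q := tau `^ _.
  lra.
apply: (le_trans (design_le _ K0 _ _ h)); rewrite lee_fin -exprMn.
have -> : 2 * (3 * tau `^ (al * b / d%:R)) = 6 * tau `^ (al * b / d%:R) by ring.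
rewrite exprMn -(powR_mulrn d q0) -powRrM divfK ?gt_eqF//.
by rewrite -taub -powRrM (mulrC al) lexx.
Qed.

Lemma hard_instance_in_class sig : Pi' theta (PP sig, QQ sig).
Proof.
have [_ [[_ cl0 rl0 CB0 _] Cg]] := adm.
have [[_ bP01 bQ01 _] _] := adm.
split; first exact: unit_cube_law (etaP01 sig).
split; first exact: unit_cube_law (etaQ01 sig).
have mP A : measurable A -> marginal (PP sig) A = design K A.
  by move=> mA; apply: marginal_label_law => //; exact: etaP01.
have mQ A : measurable A -> marginal (QQ sig) A = design K A.
  by move=> mA; apply: marginal_label_law => //; exact: etaQ01.
(* The threshold on [c_lambda] also serves the density bounds, since its base is at most
   [1 / (16 d)]. *)
have cld : c_lambda theta < (1 / 2) ^+ d.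
  apply: (le_lt_trans clam); rewrite ltrXn2r ?gtn_eqF//.
  - by rewrite divr_ge0// le_min !invr_ge0 (ltW rl0)/= mulr_ge0.
  - rewrite ltr_pdivrMr//; apply: le_lt_trans (_ : (2 * d%:R)^-1 < _).
      by rewrite ge_min lexx orbT.
    rewrite invf_plt ?posrE ?mulr_gt0//; have : 1 <= d%:R :> R by rewrite ler1n.
    lra.
exists (comb_domain K), (etaP sig), (etaQ sig); split.
  split; first exact: comb_domain_cube.
    by apply: label_law_is_regression; exact: etaP01.
  by apply: label_law_is_regression; exact: etaQ01.
split.
- split.
  + by rewrite (support_design d0 K K0 _ mP).
  + by rewrite (support_design d0 K K0 _ mQ).
  + by move=> rho x rho0 Cx;
    exact: (comb_domain_strong_density d0 K0 rl0 clam rho0 Cx).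
  + exact: (design_density _ K0 _ mP).
  + exact: (design_density _ K0 _ mQ).
- split => x1 x2 D1 D2.
    by apply: (@bump_hoelder R d K k K0 k0 _ _ _ _ n) => //; exact: ltW.
  by apply: (@bump_hoelder R d K k K0 k0 _ _ _ _ n) => //; exact: ltW.
- exact: tsybakov_bump.
move=> x Dx; have [h1 h2] := @bump_signal R d K k kappa gam b sig x (ltW kap0) gam0.
split => //; rewrite h2.
have p0 : 0 <= `|etaQ sig x - 1 / 2| `^ gam by exact: powR_ge0.
have /andP[Cg0 Cg1] := Cg; apply/andP; split.
  by apply: ler_piMl => //; exact: ltW.
by apply: ler_peMl => //; rewrite invf_ge1// ltW.
Qed.

Hypothesis K1 : (1 < K)%N.
Hypothesis s1 : s <= 1.

(** The two laws differ on one corner cell, where the regression function is [c * r^e] away from 1/2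
    and whose mass is at most [2^d * r^d]. At least two periods per axis keep this bound below 1. *)
Lemma affinity_bump (c e : R) (sig : {ffun J -> bool}) j :
  0 < c -> c <= 1 / 2 -> 0 < e ->
  affinity_ge (label_law (design K) (bump K k c e sig))
    (label_law (design K) (bump K k c e (flip j sig)))
    ((1 - 4 * (c * r `^ e) ^+ 2 * (2 ^+ d * r ^+ d)) ^+ 2).
Proof.
move=> c0 c1 e0.
have re1 : r `^ e <= 1.
  by rewrite -[leRHS](powRr0 r); apply: ger_powR; [rewrite r0|exact: ltW].
have re0 : 0 <= r `^ e by exact: powR_ge0.
have h0 : 0 <= c * r `^ e by rewrite mulr_ge0// ltW.
have h1 : c * r `^ e <= 1 / 2.
  by rewrite -[leRHS]mulr1; apply: ler_pM => //; exact: ltW.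
have h2 : 4 * (c * r `^ e) ^+ 2 <= 1.
  have : (c * r `^ e) ^+ 2 <= (1 / 2) ^+ 2 by rewrite ler_sqr ?nnegrE//; lra.
  lra.
have w1 : 2 ^+ d * r ^+ d <= 1.
  rewrite -exprMn exprn_ile1// ?mulr_ge0 ?(ltW r0)//.
  by rewrite ler_pdivrMr// mul1r ler_nat.
have w0 : 0 <= 2 ^+ d * r ^+ d by rewrite mulr_ge0 ?exprn_ge0// ltW.
pose B : set pt := [set x | supnorm x < s] `&` [set x | cell K x = j].
have mB : measurable B.
  by apply: measurableI; [exact: measurable_supnorm_lt|exact: measurable_cell].
apply: (@affinity_label_law R _ _ (design K) (bump K k c e sig)
  (bump K k c e (flip j sig)) B) => //.
- by move=> x; apply: bump01 => //; [rewrite (ltW c0)|exact: ltW].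
- by move=> x; apply: bump01 => //; [rewrite (ltW c0)|exact: ltW].
- apply: design_le => //; apply: le_trans (lambda_cell_le K0 j).
  have mD := @measurable_comb_domain R d K.
  apply: le_lambda.
  + exact: measurableI.
  + by apply: measurableI => //; exact: measurable_cell.
  + by move=> x [[_ xj] Dx]; split.
- by rewrite mulr_ile1// mulr_ge0// exprn_ge0.
- move=> x NBx; apply/esym; apply: bump_flip_neq => -[xs xj].
  by apply: NBx.
move=> x [xs xj]; split; first exact: bump_flip.
have -> : `|bump K k c e sig x - 1 / 2| = c * width K k x `^ e.
  by apply: bump_abs; exact: ltW.
by rewrite (width_corner _ _ K0).
Qed.

(** As [4 * c^2 <= 1], the loss per observation is [X <= 2^d * r^(2 e + d)], so [m * X <= 1/8].
    Bernoulli's inequality gives [(1 - X)^m >= 7/8], whose square exceeds 3/4. *)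
Lemma affinity_pow_ge (c e : R) (m : nat) : 0 < c -> c <= 1 / 2 -> 0 < e ->
  m%:R * r `^ (2 * e + d%:R) <= (1 / 2) ^+ d / 8 ->
  3 / 4 <= ((1 - 4 * (c * r `^ e) ^+ 2 * (2 ^+ d * r ^+ d)) ^+ 2) ^+ m.
Proof.
move=> c0 c1 e0 H; set X := 4 * _ * _.
set P := r `^ (2 * e + d%:R) in H.
have PE : P = (r `^ e) ^+ 2 * r ^+ d.
  rewrite /P powRD; last by rewrite (gt_eqF r0) implybT.
  by rewrite powR_mulrn ?(ltW r0)// (mulrC 2) powRrM powR_mulrn ?powR_ge0.
have P0 : 0 <= P by exact: powR_ge0.
have P1 : P <= 1.
  rewrite -[leRHS](powRr0 r); apply: ger_powR; first by rewrite r0.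
  by rewrite addr_ge0// mulr_ge0// ltW.
have D0 : 0 < 2 ^+ d :> R by exact: exprn_gt0.
have XE : X = 4 * c ^+ 2 * (2 ^+ d * P) by rewrite PE /X; ring.
have c4 : 4 * c ^+ 2 <= 1.
  have : c ^+ 2 <= (1 / 2) ^+ 2 by rewrite ler_sqr ?nnegrE//; lra.
  lra.
have DP0 : 0 <= 2 ^+ d * P by rewrite mulr_ge0// ltW.
have XP : X <= 2 ^+ d * P by rewrite XE ler_piMl.
have X0 : 0 <= X by rewrite XE mulr_ge0// mulr_ge0// sqr_ge0.
have X1 : X <= 1.
  rewrite /X; have h2 : 4 * (c * r `^ e) ^+ 2 <= 1.
    have a1 : 0 <= 4 * c ^+ 2 by rewrite mulr_ge0// sqr_ge0.
    have a2 : 0 <= (r `^ e) ^+ 2 by exact: sqr_ge0.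
    rewrite exprMn mulrA; apply: mulr_ile1 => //.
    apply: exprn_ile1; first exact: powR_ge0.
    by rewrite -[leRHS](powRr0 r); apply: ger_powR; [rewrite r0|exact: ltW].
  have a1 : 0 <= 4 * (c * r `^ e) ^+ 2 by rewrite mulr_ge0// sqr_ge0.
  have a2 : 0 <= 2 ^+ d * r ^+ d by rewrite mulr_ge0 ?exprn_ge0// ltW.
  apply: mulr_ile1 => //.
  rewrite -exprMn exprn_ile1// ?mulr_ge0 ?(ltW r0)//.
  by rewrite ler_pdivrMr// mul1r ler_nat.
have mX : m%:R * X <= 1 / 8.
  apply: (@le_trans _ _ (2 ^+ d * (m%:R * P))).
    by rewrite [leRHS]mulrCA; apply: ler_wpM2l.
  apply: (@le_trans _ _ (2 ^+ d * ((1 / 2) ^+ d / 8))); first by rewrite ler_pM2l.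
  by rewrite mulrA -exprMn (_ : 2 * (1 / 2) = 1) ?expr1n//; field.
rewrite -exprM mulnC exprM.
have h7 : 7 / 8 <= (1 - X) ^+ m.
  apply: le_trans (bernoulli_ineq X m _); last by rewrite X0.
  lra.
have : (7 / 8) ^+ 2 <= ((1 - X) ^+ m) ^+ 2 by rewrite ler_sqr ?nnegrE//; lra.
lra.
Qed.

Lemma hard_instance_lower (nP nQ : nat) :
  nP%:R * r `^ (2 * (gam * b) + d%:R) <= (1 / 2) ^+ d / 8 ->
  nQ%:R * r `^ (2 * b + d%:R) <= (1 / 2) ^+ d / 8 ->
  ((kappa * r `^ b / 5 * (s / 2) ^+ d)%:E <= minimax_risk nP nQ (@Pi' R d theta))%E.
Proof.
move=> hP hQ; apply: minimax_risk_ge => f.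
pose B : set pt := [set x | supnorm x < s].
have [sig hsig] : exists sig, ((kappa * r `^ b / 5)%:E * design K B <=
    excess_risk f (PP sig, QQ sig))%E.
  have aP := affinity_pow_ge _ _ _ kapg0 kapg1 gb0 hP.
  have aQ := affinity_pow_ge _ _ _ kap0 kap1 b0 hQ.
  apply: (@exists_excess_risk_ge R d _ nP nQ (design K) (cell K) etaP etaQ B
    (best K k) (kappa * r `^ b)
    ((1 - 4 * (kappa `^ gam * r `^ (gam * b)) ^+ 2 * (2 ^+ d * r ^+ d)) ^+ 2)
    ((1 - 4 * (kappa * r `^ b) ^+ 2 * (2 ^+ d * r ^+ d)) ^+ 2)).
  - exact: measurable_cell.
  - exact: measurable_supnorm_lt.
  - exact: measurable_best.
  - by move=> sig x; rewrite /B/best/= => ->.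
  - by rewrite mulr_ge0 ?powR_ge0// ltW.
  - exact: etaQ01.
  - by move=> sig x; apply: bump_sign; exact: ltW.
  - move=> sig x xs.
    have -> : `|etaQ sig x - 1 / 2| = kappa * width K k x `^ b.
      by apply: bump_abs; exact: ltW.
    by rewrite (width_corner _ _ K0).
  - exact: sqr_ge0.
  - exact: sqr_ge0.
  - by move=> sig j; exact: affinity_bump.
  - by move=> sig j; exact: affinity_bump.
  (* Each sample keeps affinity 3/4, and the product 9/16 is above the 1/2 required for testing. *)
  - apply: (@le_trans _ _ (3 / 4 * (3 / 4))); first by lra.
    by apply: ler_pM => //; lra.
exists (PP sig, QQ sig); first exact: hard_instance_in_class.
apply: le_trans hsig; rewrite EFinM; apply: lee_wpmul2l.
  by rewrite lee_fin !mulr_ge0 ?powR_ge0// ltW.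
have s0 : 0 < s by rewrite mulr_gt0// ltr0n.
have s20 : 0 <= (s / 2) ^+ d by rewrite exprn_ge0// divr_ge0// ltW.
apply: design_ge => //.
by rewrite setIC; apply: lambda_corner_ge => //; rewrite s0.
Qed.

End hard_instance.

(** * Choice of the mesh *)

Lemma minimax_risk_mono {R : realType} {d nP nQ : nat}
    (C C' : set (probability (obs R d) R * probability (obs R d) R)) :
  C `<=` C' -> (minimax_risk nP nQ C <= minimax_risk nP nQ C')%E.
Proof.
move=> CC'; apply: le_ereal_inf_tmp => _ [f _ <-].
apply: (@le_trans _ _ (ereal_sup (excess_risk f @` C))).
  by apply: ereal_inf_lbound; exists f.
by apply: le_ereal_sup => _ [PQ CPQ <-]; exists PQ => //; exact: CC'.
Qed.

Lemma Pi'_sub_Pi {R : realType} {d : nat} (theta : parameters R) :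
  @Pi' R d theta `<=` @Pi R d theta.
Proof.
move=> PQ [P1 [Q1 [Om [eP [eQ [h [h1 h2 h3 h4]]]]]]].
split => //; split => //; exists Om, eP, eQ; split => //; split => //.
by move=> x Ox; have [a /andP[b _]] := h4 x Ox.
Qed.

Section rate.
Context {R : realType} {d : nat}.
Hypothesis d0 : (0 < d)%N.
Variable theta : parameters R.
Let al := alpha theta.
Let gam := gamma theta.
Variables (b kappa : R) (n : nat).
Hypothesis adm : admissible theta.
Hypothesis b0 : 0 < b.
Hypothesis bQ : betaQ theta <= b.
Hypothesis bP : betaP theta <= gam * b.
Hypothesis n0 : (0 < n)%N.
Hypothesis bn : b <= n%:R.
Hypothesis gbn : gam * b <= n%:R.
Hypothesis kap0 : 0 < kappa.
Hypothesis kap1 : kappa <= 1 / 2.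
Hypothesis kapg1 : kappa `^ gam <= 1 / 2.
Hypothesis kapC : 6 * n%:R * kappa <= C_beta theta.
Hypothesis kapgC : 6 * n%:R * kappa `^ gam <= C_beta theta.
Hypothesis clam : c_lambda theta <=
  (Num.min (r_lambda theta)^-1 (2 * d%:R)^-1 / 8) ^+ d.
Hypothesis calpha : 6 ^+ d * kappa `^ (- al) <= C_alpha theta.
Let D : R := 2 * b + d%:R.
Let D' : R := 2 * (gam * b) + d%:R.
Let eps : R := (1 / 2) ^+ d / 8.
(** Chosen so that [c1^D] and [c1^D'] are both at least [1 / eps]: a mesh [1 / K] with
    [K >= c1 * N^(1/D)] then hides a single cell from both samples. *)
Let c1 : R := Num.max (eps^-1 `^ D^-1) (eps^-1 `^ D'^-1).

Let gam0 : 0 < gam. Proof. by case: adm => _ [[]]. Qed.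
Let al0 : 0 <= al. Proof. by case: adm => -[]. Qed.
Let dpos : 0 < d%:R :> R. Proof. by rewrite ltr0n. Qed.
Let gb0 : 0 < gam * b. Proof. exact: mulr_gt0. Qed.
Let D0 : 0 < D. Proof. by rewrite addr_gt0// mulr_gt0. Qed.
Let D'0 : 0 < D'. Proof. by rewrite addr_gt0// mulr_gt0. Qed.
Let eps0 : 0 < eps. Proof. by rewrite divr_gt0// exprn_gt0. Qed.
Let c10 : 0 < c1. Proof. by rewrite lt_max powR_gt0// invr_gt0. Qed.

Lemma lower_of_resolution (K nP nQ : nat) : (1 < K)%N -> al * b <= d%:R ->
  nP%:R * K%:R^-1 `^ D' <= eps -> nQ%:R * K%:R^-1 `^ D <= eps ->
  ((kappa / 5 * (1 / 4) ^+ d * K%:R^-1 `^ (b * (1 + al)))%:E <=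
    minimax_risk nP nQ (@Pi' R d theta))%E.
Proof.
move=> K1 abd hP hQ; have K0 : (0 < K)%N by exact: ltnW.
have Kpos : 0 < K%:R :> R by rewrite ltr0n.
set r : R := K%:R^-1.
have r0 : 0 < r by rewrite invr_gt0.
have rK : r * K%:R = 1 by rewrite mulVf// gt_eqF.
have r2 : r <= 1 / 2.
  by rewrite div1r lef_pV2 ?posrE// ler_nat.
have r01 : 0 < r <= 1 by rewrite r0/=; lra.
pose q := r `^ (al * b / d%:R).
have q0 : 0 < q by exact: powR_gt0.
have e1 : al * b / d%:R <= 1 by rewrite ler_pdivrMr// mul1r.
have e0 : 0 <= al * b / d%:R by rewrite !mulr_ge0 ?invr_ge0// ltW.
have q1 : q <= 1 by rewrite -[leRHS](powRr0 r); exact: ger_powR.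
have rq : r <= q by exact: ger1_powR.
(* The side [s = k * r] lies between [q / 2] and [q / 2 + r]. As [r <= q] and [r <= 1/2], it is
   below both [2 * q] and 1, while [s / 2 >= q / 4] explains the factor [(1 / 4) ^+ d]. *)
pose k := (Num.truncn (q * K%:R / 2)).+1.
have /andP[k1 k2] : (Num.truncn (q * K%:R / 2))%:R <= q * K%:R / 2 < k%:R.
  by apply: truncn_itv; rewrite divr_ge0// mulr_ge0// ltW.
have ks : k%:R * r <= q / 2 + r.
  have : k%:R <= q * K%:R / 2 + 1 by rewrite /k -natr1 lerD2r.
  move/(ler_wpM2r (ltW r0)) => /le_trans; apply.
  rewrite (_ : (q * K%:R / 2 + 1) * r = q / 2 * (r * K%:R) + r); last by ring.
  by rewrite rK mulr1.
have ks' : q / 2 <= k%:R * r.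
  move: k2 => /ltW /(ler_wpM2r (ltW r0)); apply: le_trans.
  rewrite (_ : q * K%:R / 2 * r = q / 2 * (r * K%:R)); last by ring.
  by rewrite rK mulr1.
have s1 : k%:R * r <= 1 by lra.
have s2 : k%:R * r <= 2 * q by lra.
have := @hard_instance_lower R d d0 theta b kappa n K k K0 isT adm b0 bQ bP n0
  bn gbn kap0 kap1 kapg1 kapC kapgC clam calpha abd s2 K1 s1 nP nQ hP hQ.
apply: le_trans; rewrite lee_fin -/r.
have -> : r `^ (b * (1 + al)) = r `^ b * q ^+ d.
  rewrite /q -powR_mulrn ?powR_ge0// -powRrM divfK ?gt_eqF//.
  by rewrite -powRD; [congr (_ `^ _); ring|rewrite (gt_eqF r0) implybT].
have -> : kappa / 5 * (1 / 4) ^+ d * (r `^ b * q ^+ d) =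
    kappa * r `^ b / 5 * ((1 / 4) * q) ^+ d.
  by rewrite [(1 / 4 * q) ^+ d]exprMn; move: ((1 / 4) ^+ d) (q ^+ d) => A B; ring.
have h0 : 0 <= kappa * r `^ b / 5 by rewrite divr_ge0// mulr_ge0 ?powR_ge0// ltW.
apply: ler_wpM2l => //; rewrite lerXn2r ?nnegrE//.
- by rewrite mulr_ge0// ltW.
- by rewrite divr_ge0// mulr_ge0// ltW.
- lra.
Qed.

(** [N] is the effective sample size: [nQ <= N] and [nP <= N^(D'/D)], so the single choice of [K] of
    order [N^(1/D)] meets both indistinguishability conditions. *)
Lemma lower_rate : exists2 c : R, 0 < c & forall nP nQ : nat, al * b <= d%:R ->
  ((c * (nP%:R `^ (D / D') + nQ%:R) `^ (- (b * (1 + al) / D)))%:E <=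
    minimax_risk nP nQ (@Pi' R d theta))%E.
Proof.
have e0 : 0 < b * (1 + al) by rewrite mulr_gt0//; move: al0; lra.
exists (kappa / 5 * (1 / 4) ^+ d * (c1 + 2) `^ (- (b * (1 + al)))).
  rewrite mulr_gt0 ?powR_gt0//; last by move: c10; lra.
  by rewrite mulr_gt0 ?exprn_gt0// divr_gt0.
move=> nP nQ abd; set N := _ + nQ%:R.
have E0 : 0 < D / D' by rewrite divr_gt0.
have N0 : 0 <= N by rewrite addr_ge0// powR_ge0.
pose x := c1 * N `^ D^-1.
have x0 : 0 <= x by rewrite mulr_ge0 ?powR_ge0// ltW.
(* Adding 2 gives [K >= x] and also [K >= 2], whatever the sample sizes. *)
pose K := (Num.truncn x).+2.
have /andP[xK1 xK2] : (Num.truncn x)%:R <= x < (Num.truncn x).+1%:R by exact: truncn_itv.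
have Kpos : 0 < K%:R :> R by rewrite ltr0n.
have xK : x <= K%:R.
  by apply/ltW/(lt_trans xK2); rewrite ltr_nat.
have KE : K%:R <= x + 2.
  by rewrite /K -natr1 -natr1; lra.
have res (m y z : R) : 0 < z -> 0 <= m -> eps^-1 * m <= y `^ z -> 0 <= y -> y <= K%:R ->
    m * K%:R^-1 `^ z <= eps.
  move=> z0 m0 h y0 yK; have h1 : y `^ z <= K%:R `^ z.
    by rewrite ge0_ler_powR ?nnegrE ?(ltW z0) ?(ltW Kpos).
  rewrite -powR_inv1 ?(ltW Kpos)// powRAC powR_inv1 ?powR_ge0//.
  rewrite ler_pdivrMr ?powR_gt0// -ler_pdivrMl//; exact: le_trans h h1.
have xD z : 0 < z -> eps^-1 `^ z^-1 <= c1 -> eps^-1 * N `^ (z / D) <= x `^ z.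
  move=> z0 hz; rewrite /x powRM ?powR_ge0 ?(ltW c10)// -powRrM (mulrC D^-1).
  apply: ler_wpM2r; first exact: powR_ge0.
  apply: (@le_trans _ _ ((eps^-1 `^ z^-1) `^ z)).
    by rewrite -powRrM mulVf ?gt_eqF// powRr1// invr_ge0 ltW.
  by rewrite ge0_ler_powR ?nnegrE ?(ltW z0) ?powR_ge0 ?(ltW c10).
have K1 : (1 < K)%N by [].
have hQ : nQ%:R * K%:R^-1 `^ D <= eps.
  apply: (res _ x D) => //; apply: le_trans (xD D D0 _); last first.
    by rewrite le_max lexx.
  rewrite divff ?gt_eqF// powRr1// ler_pM2l ?invr_gt0//.
  by rewrite lerDr powR_ge0.
have hP : nP%:R * K%:R^-1 `^ D' <= eps.
  apply: (res _ x D') => //; apply: le_trans (xD D' D'0 _); last first.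
    by rewrite le_max lexx orbT.
  rewrite ler_pM2l ?invr_gt0//.
  apply: (@le_trans _ _ ((nP%:R `^ (D / D')) `^ (D' / D))).
    rewrite -powRrM (_ : D / D' * (D' / D) = 1) ?powRr1//.
    by field; rewrite !gt_eqF.
  by rewrite ge0_ler_powR ?nnegrE ?powR_ge0 ?divr_ge0 ?(ltW D0) ?(ltW D'0)// lerDl.
apply: le_trans (lower_of_resolution K nP nQ K1 abd hP hQ).
rewrite lee_fin -mulrA; apply: ler_wpM2l.
  by rewrite mulr_ge0 ?exprn_ge0// divr_ge0// ltW.
(* Without data [N = 0], and the power of 0 with a nonzero exponent is 0 by convention, so the bound
   is trivial. Otherwise [N >= 1], which absorbs the additive 2 in [K]. *)
move: N0; rewrite le_eqVlt => /predU1P[<-|Np].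
  rewrite powR0 ?mulr0 ?powR_ge0// oppr_eq0 gt_eqF// divr_gt0//.
have N1 : 1 <= N.
  have [nP0|nP0] := posnP nP.
    have [nQ0|nQ0] := posnP nQ.
      by move: Np; rewrite /N nP0 nQ0 powR0 ?gt_eqF// addr0 ltxx.
    by rewrite /N -[leLHS]add0r lerD ?powR_ge0// ler1n.
  rewrite /N -[leLHS]addr0 lerD// -[leLHS](powRr0 nP%:R).
  by apply: ler_powR; [rewrite ler1n|exact: ltW].
have ND1 : 1 <= N `^ D^-1.
  by rewrite -[leLHS](powRr0 N); apply: ler_powR => //; rewrite invr_ge0 ltW.
have KN : K%:R <= (c1 + 2) * N `^ D^-1.
  by apply: (le_trans KE); rewrite /x mulrDl; lra.
have c120 : 0 < c1 + 2 by move: c10; lra.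
have -> : N `^ (- (b * (1 + al) / D)) = (N `^ D^-1) `^ (- (b * (1 + al))).
  by rewrite -powRrM; congr (_ `^ _); ring.
rewrite -powRM ?powR_ge0 ?(ltW c120)//.
rewrite -[in leRHS]powR_inv1 ?(ltW Kpos)// -powRrM mulN1r !powRN.
rewrite lef_pV2 ?posrE ?powR_gt0 ?mulr_gt0 ?powR_gt0//.
by rewrite ge0_ler_powR ?nnegrE ?(ltW e0) ?(ltW Kpos)// mulr_ge0 ?powR_ge0// ltW.
Qed.

End rate.

(* The bounds fail in degenerate ranges of the constants: the classes are empty
   when c_lambda >= 1, and keep eta_Q away from 1/2 when C_alpha and C_beta are
   both small. Hence c_lambda small enough and C_alpha large enough, as
   expressed by the thresholds c0 and A0, which depend on d and on the other
   parameters only. *)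
Theorem theorem4 (R : realType) (d : nat) (hd : (0 < d)%N)
    (alpha betaP betaQ gamma r_lambda C_beta C_gamma : R) :
  exists c0 A0 : R, 0 < c0 /\ 0 < A0 /\
  forall c_lambda C_alpha : R, c_lambda <= c0 -> A0 <= C_alpha ->
  let theta := Theta alpha betaP betaQ gamma
                 c_lambda r_lambda C_beta C_alpha C_gamma in
  admissible theta ->
  exists c : R, 0 < c /\ forall nP nQ : nat,
    (gamma * betaQ < betaP -> alpha * betaP <= gamma * d%:R ->
      (minimax_risk nP nQ (@Pi' R d theta) <= minimax_risk nP nQ (@Pi R d theta))%E /\
      ((c * (nP%:R `^ ((2 * betaP + gamma * d%:R) / (gamma * (2 * betaP + d%:R)))
             + nQ%:R)
            `^ (- (betaP * (1 + alpha) / (2 * betaP + gamma * d%:R))))%:E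
        <= minimax_risk nP nQ (@Pi' R d theta))%E)
    /\
    (betaP <= gamma * betaQ -> alpha * betaQ <= d%:R ->
      (minimax_risk nP nQ (@Pi' R d theta) <= minimax_risk nP nQ (@Pi R d theta))%E /\
      ((c * (nP%:R `^ ((2 * betaQ + d%:R) / (2 * gamma * betaQ + d%:R))
             + nQ%:R)
            `^ (- (betaQ * (1 + alpha) / (2 * betaQ + d%:R))))%:E
        <= minimax_risk nP nQ (@Pi' R d theta))%E).
Proof.
(* Thresholds are owed before admissibility is known; if one of these signs is wrong, no parameters
   are admissible and any thresholds do. *)
have [[rl0 CB0]|H] := pselect (0 < r_lambda /\ 0 < C_beta); last first.
  exists 1, 1; split => //; split => // cl Ca _ _ theta [_ [[_ _ rl0 CB0 _] _]].
  by case: H.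
pose b := Num.max (betaP / gamma) betaQ.
pose n := (Num.truncn (Num.max b (gamma * b))).+1.
(* [m] is the common ceiling for [kappa] and [kappa^gamma]: 1/2 keeps the regression functions in
   [0, 1], the other term is the Hoelder budget of [bump_hoelder]. The minimum with [m^(1/gamma)]
   below puts [kappa^gamma] under the same ceiling. *)
pose m := Num.min (1 / 2) (C_beta / (6 * n%:R)).
pose kappa := Num.min m (m `^ gamma^-1).
have npos : 0 < n%:R :> R by rewrite ltr0n.
have m0 : 0 < m by rewrite lt_min divr_gt0//= divr_gt0// mulr_gt0.
have kap0 : 0 < kappa by rewrite lt_min m0 powR_gt0.
have dpos : 0 < d%:R :> R by rewrite ltr0n.
exists ((Num.min r_lambda^-1 (2 * d%:R)^-1 / 8) ^+ d).
exists (6 ^+ d * kappa `^ (- alpha)).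
split.
  by rewrite exprn_gt0// divr_gt0// lt_min !invr_gt0 rl0 mulr_gt0.
split; first by rewrite mulr_gt0 ?exprn_gt0// powR_gt0.
move=> cl Ca clE CaE theta adm.
have [[al0 bP01 bQ01 bmax] [[gam0 _ _ _ _] _]] := adm.
rewrite /= in al0 bP01 bQ01 bmax gam0.
have bPb : betaP <= gamma * b.
  by rewrite mulrC -ler_pdivrMr// le_max lexx.
have bQb : betaQ <= b by rewrite le_max lexx orbT.
have b0 : 0 < b.
  move: bmax; rewrite lt_max => /orP[h|h]; last exact: lt_le_trans bQb.
  by apply: (@lt_le_trans _ _ (betaP / gamma)); rewrite ?divr_gt0// le_max lexx.
have /ltW nE : Num.max b (gamma * b) < n%:R by exact: truncnS_gt.
have bn : b <= n%:R by apply: le_trans nE; rewrite le_max lexx.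
have gbn : gamma * b <= n%:R by apply: le_trans nE; rewrite le_max lexx orbT.
have mC : 6 * n%:R * m <= C_beta.
  by rewrite mulrC -ler_pdivlMr ?mulr_gt0// ge_min lexx orbT.
have m2 : m <= 1 / 2 by rewrite ge_min lexx.
have km : kappa <= m by rewrite ge_min lexx.
have kgm : kappa `^ gamma <= m.
  apply: (@le_trans _ _ ((m `^ gamma^-1) `^ gamma)).
    by rewrite ge0_ler_powR ?nnegrE ?powR_ge0 ?(ltW gam0) ?(ltW kap0)// ge_min lexx orbT.
  by rewrite -powRrM mulVf ?gt_eqF// powRr1// ltW.
have kC x : x <= m -> 6 * n%:R * x <= C_beta.
  by move=> xm; apply: le_trans mC; rewrite ler_wpM2l// mulr_ge0// ltW.
have [c c0 cE] := @lower_rate R d hd theta b kappa n adm b0 bQb bPb isT bn gbn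
  kap0 (le_trans km m2) (le_trans kgm m2) (kC _ km) (kC _ kgm) clE CaE.
exists c; split=> // nP nQ.
have mono := @minimax_risk_mono R d nP nQ _ _ (@Pi'_sub_Pi R d theta).
rewrite /= in cE.
split=> [ha hb|ha hb]; split => //.
  (* The regime decides which term of the maximum is [b]; substituting it into the common rate gives
     the stated exponents. *)
  have bE : b = betaP / gamma by rewrite /b max_l// ler_pdivlMr// mulrC ltW.
  have abd : alpha * b <= d%:R.
    by rewrite bE mulrA ler_pdivrMr// (mulrC d%:R).
  have bP0 : 0 < betaP.
    by apply: le_lt_trans ha; rewrite mulr_ge0 ?(ltW gam0)//; case/andP: bQ01.
  have := cE nP nQ abd; rewrite bE.
  have -> : (2 * (betaP / gamma) + d%:R) / (2 * (gamma * (betaP / gamma)) + d%:R) =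
      (2 * betaP + gamma * d%:R) / (gamma * (2 * betaP + d%:R)).
    by field; rewrite !gt_eqF ?addr_gt0 ?mulr_gt0.
  have -> : betaP / gamma * (1 + alpha) / (2 * (betaP / gamma) + d%:R) =
      betaP * (1 + alpha) / (2 * betaP + gamma * d%:R).
    by field; rewrite !gt_eqF ?addr_gt0 ?mulr_gt0.
  by [].
have bE : b = betaQ by rewrite /b max_r// ler_pdivrMr// mulrC.
have := cE nP nQ; rewrite bE => /(_ hb).
by rewrite (mulrA 2).
Qed.
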